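(* Let $q\ge4$ be an even prime power (a power of $2$), $n\ge3$ an odd integer, and $s=\frac{q^n+1}{q+1}$. Let $\mathbb{F}_{q^{2n}}(x,y)$ be the function field of the curve $$y^{q^n+1}=x(x+1)\left(\frac{x^{q-1}+1}{x+1}\right)^{q+1},$$ let $Q_\infty,Q_0,Q_1$ be its totally ramified places over $\mathbb{F}_{q^{2n}}(x)$ lying over the pole of $x$, the zero of $x$ and the zero of $x-1$ respectively, and let $Q\in\{Q_0,Q_1\}$. Below all parameters $a,b,a_i,b_i$ are integers. Then: (i) For $0\le a\le s-2$ and $1\le b\le s-1-a$, $$\left((q^n+1)(q-1)-(s-a)(q^2-q),\ b\right)\in G_0(Q_\infty,Q).$$ (ii) For $1\le a_i\le q+1$ and $1\le b_i\le(q^2-q-2a_i)\frac{q^{n-1}-1}{q^2-1}$, $i=1,2$, $$\left(\frac{a_2(q^n-2q^{n-1}+1)}{q-1}-b_2,\ \frac{a_1(q^n-2q^{n-1}+1)}{q-1}-b_1\right)\in G_0(Q_0,Q_1).$$ (iii) For $1\le a_2\le a_1\le q+1$, $$0\le b_1\le\begin{cases}2a_1\frac{q^{n-1}-1}{q^2-1},&\text{if }1\le a_1\le\frac q2,\\[2pt]\frac{q^{n-1}-q}{q-1},&\text{if }\frac q2+1\le a_1\le q+1,\end{cases}$$ and $1\le b_2\le(q^2-q-2a_2)\frac{q^{n-1}-1}{q^2-1}$, the pairs $$\left(\frac{a_1(q^n-2q^{n-1}+1)}{q-1}+b_1,\ \frac{a_2(q^n-2q^{n-1}+1)}{q-1}-b_2\right)$$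 and $$\left(\frac{a_2(q^n-2q^{n-1}+1)}{q-1}-b_2,\ \frac{a_1(q^n-2q^{n-1}+1)}{q-1}+b_1\right)$$ are pure gaps at $Q_0,Q_1$.
   Context: For distinct rational places $P_1,P_2$ of a function field $F$, a pair $(s_1,s_2)\in\mathbb{N}^2$ ($\mathbb{N}=\{0,1,2,\dots\}$) is a pure gap at $P_1,P_2$ if $\ell(s_1P_1+s_2P_2)=\ell(s_1P_1+s_2P_2-P_j)$ for both $j=1,2$, where $\ell(D)$ is the dimension over the constant field of the Riemann-Roch space $\mathcal{L}(D)=\{z\in F\mid(z)+D\ge0\}\cup\{0\}$. $G_0(P_1,P_2)$ denotes the set of pure gaps at $P_1,P_2$. The places $Q_\infty,Q_0,Q_1$ are the only totally ramified places in the extension $\mathbb{F}_{q^{2n}}(x,y)/\mathbb{F}_{q^{2n}}(x)$, and they have degree one. *)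

(* Defs.v *)
From HB Require Import structures.
From mathcomp Require Export all_boot all_order all_algebra all_field.
From mathcomp Require Export fraction boolp classical_sets.
From mathcomp Require Export freeg.

Set Implicit Arguments.
Unset Strict Implicit.
Unset Printing Implicit Defensive.

Import Order.TTheory GRing.Theory Num.Theory.

Local Open Scope classical_set_scope.
Local Open Scope ring_scope.

(* A place P of F/K is represented by its normalised discrete valuation v_P.
   The value at 0, which should be +oo, is set to the dummy value 0 so that a
   place has exactly one representative; v_P is meaningful on nonzero elements
   only.  In [place_onto], t is automatically nonzero. *)
Record place (K F : fieldType) (iota : {rmorphism K -> F}) := Place {
  place_val :> F -> int;
  place_val0 : place_val 0 = 0;
  place_valM : forall z w, z != 0 -> w != 0 ->
    place_val (z * w) = place_val z + place_val w;
  place_valD : forall z w, z != 0 -> w != 0 -> z + w != 0 ->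
    Num.min (place_val z) (place_val w) <= place_val (z + w);
  place_cst : forall c : K, place_val (iota c) = 0;
  place_onto : exists t, place_val t = 1
}.

HB.instance Definition _ (K F : fieldType) (iota : {rmorphism K -> F}) :=
  gen_eqMixin (place iota).
HB.instance Definition _ (K F : fieldType) (iota : {rmorphism K -> F}) :=
  gen_choiceMixin (place iota).

Section RiemannRoch.
Variables (K F : fieldType) (iota : {rmorphism K -> F}).

Definition divisor := {freeg (place iota) / int}.

Definition prime_divisor (P : place iota) : divisor := << 1 *g P >>.

Definition RRspace (D : divisor) : set F :=
  [set z | z = 0 \/ forall P : place iota, 0 <= P z + coeff P D].

Definition is_basis (V : set F) (m : nat) (e : 'I_m -> F) : Prop :=
  [/\ forall i, V (e i),
      forall c : 'I_m -> K,
        \sum_(i < m) iota (c i) * e i = 0 -> forall i, c i = 0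
    & forall z, V z ->
        exists c : 'I_m -> K, z = \sum_(i < m) iota (c i) * e i].

(* The default 0 is used only for a subspace of infinite dimension; Riemann-Roch
   spaces of a function field are finite-dimensional. *)
Definition Kdim (V : set F) : nat :=
  xget 0%N [set m : nat | exists e : 'I_m -> F, is_basis V e].

Definition ell (D : divisor) : nat := Kdim (RRspace D).

(* G_0(P1, P2), for distinct rational places P1 and P2.  Pairs of naturals are
   encoded as pairs of nonnegative integers. *)
Definition pure_gaps (P1 P2 : place iota) : set (int * int) :=
  [set s | [/\ 0 <= s.1, 0 <= s.2 &
    let D := prime_divisor P1 *~ s.1 + prime_divisor P2 *~ s.2 in
    ell D = ell (D - prime_divisor P1) /\
    ell D = ell (D - prime_divisor P2)]].

End RiemannRoch.

(* The rational function field K(x). *)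
Notation ratfun K := {fraction {poly K}}.

Section Extension.
Variable K : fieldType.

Definition cst_ratfun : {rmorphism K -> ratfun K} :=
  (@tofrac {poly K}) \o polyC.

Definition ratfun_x : ratfun K := tofrac 'X.

Variable F : fieldExtType (ratfun K).

Definition cst_ext : {rmorphism K -> F} := in_alg F \o cst_ratfun.

(* Q | P, i.e. the maximal ideal of P is contained in that of Q. *)
Definition lies_over (Q : place cst_ext) (P : place cst_ratfun) : Prop :=
  forall f : ratfun K, 0 < P f -> 0 < Q f%:A.

Definition has_ramification_index (Q : place cst_ext) (P : place cst_ratfun)
    (e : nat) : Prop :=
  lies_over Q P /\ forall f : ratfun K, Q f%:A = P f *+ e.

(* The ramification index is the degree [F : K(x)]. *)
Definition totally_ramified (Q : place cst_ext) (P : place cst_ratfun) : Prop :=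
  has_ramification_index Q P (\dim {: F}).

End Extension.

(* Main.v *)
Require Import Defs.
From mathcomp Require Import generic_quotient cyclic.
From mathcomp Require Import zify ring lra.

Set Implicit Arguments.
Unset Strict Implicit.
Unset Printing Implicit Defensive.

Import Order.TTheory GRing.Theory Num.Theory.
Local Open Scope classical_set_scope.
Local Open Scope ring_scope.

(** Write N = q^n + 1 and s = N / (q + 1), and let f be the polynomial
    (x^(q-1) + 1) / (x + 1), which is separable of degree q - 2 and prime to
    x (x + 1). In characteristic 2 the curve is y^N = x (x - 1) f^(q+1), a Kummer
    extension of K(x), because K contains the N-th roots of unity.

    A pair is a pure gap as soon as no function z of the Riemann-Roch space
    attains the prescribed pole order at either of the two places: the spaces
    themselves, and not only their dimensions, are then equal ([pure_gapsI]).

    Expand z as the sum of the g_k y^k for k < N, with g_k in K(x). At the three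
    totally ramified places y has order 1, 1 and - (q^2 - q), all prime to N, so
    the terms have pairwise distinct orders, and the order of z is the least of
    them. At any other place the terms are regular if all the conjugates of z
    are, since each term is an average of conjugates. Hence any order of z
    at one of the three places is attained by a single monomial g y^k which
    belongs to the same Riemann-Roch space ([kummer_component]).

    Over a zero of f, the order of y is the ramification index divided by s. So
    the coefficient g of such a monomial has poles of order at most
    j = floor(k / s) at the zeros of f, and no other pole outside 0, 1 and infinity. The product
    formula bounds the sum of the orders of g at 0, 1 and infinity by
    j (q - 2) ([component_bound]). This uses that a pole of g on the affine line is
    seen by some place of the extension, that is, that every irreducible
    polynomial has a place above it. Such a place is obtained from a subring that
    is maximal among those in which the polynomial stays a nonunit
    ([maximal_subring_valuation], [exists_place_over]).

    The theorem is then a statement about integers: the prescribed order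
    determines k and the order of g at one place, the other two orders bound the
    orders of g from below, and the sum exceeds j (q - 2)
    ([two_place_arith], [infinity_arith_finite],
    [infinity_arith_infinite]). *)

(** * Values at a place *)

Section PlaceTheory.
Variables (K F : fieldType) (iota : {rmorphism K -> F}).
Implicit Types (P : place iota) (z w : F) (m : int).

Lemma place1 P : P 1 = 0.
Proof. by rewrite -(rmorph1 iota) place_cst. Qed.

Lemma placeV P z : P z^-1 = - P z.
Proof.
have [->|z0] := eqVneq z 0; first by rewrite invr0 place_val0 oppr0.
by apply/eqP; rewrite -addr_eq0 -place_valM ?invr_eq0 // mulVf // place1.
Qed.

Lemma placeX P z n : P (z ^+ n) = P z *+ n.
Proof.
have [->|z0] := eqVneq z 0.
  by rewrite expr0n; case: n => [|n]; rewrite ?place1 ?place_val0 ?mul0rn.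
elim: n => [|n IHn]; first by rewrite place1.
by rewrite exprS place_valM ?expf_neq0 // IHn mulrS.
Qed.

Lemma place_div P z w : z != 0 -> w != 0 -> P (z / w) = P z - P w.
Proof. by move=> z0 w0; rewrite place_valM ?invr_eq0 // placeV. Qed.

Lemma placeN P z : P (- z) = P z.
Proof.
have [->|z0] := eqVneq z 0; first by rewrite oppr0.
have n1: (-1 : F) != 0 by rewrite oppr_eq0 oner_eq0.
have: P (-1) *+ 2 = 0 by rewrite -placeX sqrrN expr1n place1.
rewrite -(mulN1r z) place_valM // => /eqP; rewrite mulrn_eq0 /= => /eqP ->.
by rewrite add0r.
Qed.

(** The value at 0 is a dummy; this predicate restores the convention
    that 0 has infinite value, so that it defines an additive subgroup. *)
Definition val_ge P m : set F := [set z | z = 0 \/ m <= P z].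

Lemma val_geD P m z w : val_ge P m z -> val_ge P m w -> val_ge P m (z + w).
Proof.
move=> [->|mz]; first by rewrite add0r.
move=> [->|mw]; first by rewrite addr0; right.
have [->|z0] := eqVneq z 0; first by rewrite add0r; right.
have [->|w0] := eqVneq w 0; first by rewrite addr0; right.
have [->|zw0] := eqVneq (z + w) 0; first by left.
by right; apply: le_trans (place_valD P z0 w0 zw0); rewrite le_min mz.
Qed.

Lemma val_geM P m m' z w :
  val_ge P m z -> val_ge P m' w -> val_ge P (m + m') (z * w).
Proof.
move=> [->|mz]; first by rewrite mul0r; left.
move=> [->|mw]; first by rewrite mulr0; left.
have [->|z0] := eqVneq z 0; first by rewrite mul0r; left.
have [->|w0] := eqVneq w 0; first by rewrite mulr0; left.
by right; rewrite place_valM // lerD.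
Qed.

Lemma val_ge_cst P c : val_ge P 0 (iota c).
Proof. by right; rewrite place_cst. Qed.

Lemma val_ge_sum P m (I : Type) (r : seq I) (p : pred I) (z : I -> F) :
  (forall i, p i -> val_ge P m (z i)) -> val_ge P m (\sum_(i <- r | p i) z i).
Proof. by move=> Hz; apply: big_ind => //; [left|exact: val_geD]. Qed.

(** In an ultrametric sum a strictly dominant term decides the value. *)
Lemma place_dominant P z w :
  z != 0 -> val_ge P (P z + 1) w -> z + w != 0 /\ P (z + w) = P z.
Proof.
move=> z0 [->|Pw]; first by rewrite addr0.
have zw0 : z + w != 0.
  apply: contraTneq Pw => /eqP; rewrite addr_eq0 => /eqP ->.
  by rewrite placeN -ltNge ltzD1.
split=> //; apply/eqP; rewrite eq_le.
have [->|w0] := eqVneq w 0; first by rewrite addr0 lexx.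
apply/andP; split; last first.
  by apply: le_trans (place_valD P z0 w0 zw0); rewrite le_min lexx; lia.
have := @place_valD _ _ _ P (z + w) (- w) zw0; rewrite addrK oppr_eq0 => /(_ w0 z0).
rewrite placeN ge_min => /orP[//|]; lia.
Qed.

(** Terms with pairwise distinct values cannot cancel: the value of the sum
    is the least value of a term. *)
Lemma place_sum_distinct P (I : finType) (z : I -> F) i0 :
  (forall i j, z i != 0 -> z j != 0 -> P (z i) = P (z j) -> i = j) ->
  z i0 != 0 ->
  exists i, [/\ z i != 0, \sum_i z i != 0, P (\sum_i z i) = P (z i) &
    forall j, z j != 0 -> P (z i) <= P (z j)].
Proof.
move=> Pinj zi0.
case: (@Order.TotalTheory.arg_minP _ _ _ i0 (fun i => z i != 0)
         (fun i => P (z i)) zi0) => i zi imin.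
have [] := @place_dominant P (z i) (\sum_(j | j != i) z j) zi.
  apply: val_ge_sum => j ji; have [->|zj] := eqVneq (z j) 0; first by left.
  right; rewrite lezD1 lt_neqAle imin // andbT.
  by apply: contra_neq ji => /Pinj ->.
have -> : z i + \sum_(j | j != i) z j = \sum_j z j by rewrite [RHS](bigD1 i).
by move=> s0 Ps; exists i.
Qed.

(** A pure gap at P1, P2 is witnessed by the equality of Riemann-Roch spaces
    themselves, so no dimension has to be computed. *)
Lemma pure_gapsI (P1 P2 : place iota) (s1 s2 : int) :
  P1 <> P2 -> 0 <= s1 -> 0 <= s2 ->
  (forall z, z != 0 -> - s1 <= P1 z -> - s2 <= P2 z ->
     (forall P, P <> P1 -> P <> P2 -> 0 <= P z) ->
     P1 z != - s1 /\ P2 z != - s2) ->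
  pure_gaps P1 P2 (s1, s2).
Proof.
move=> P12 s1_ge0 s2_ge0 H; split=> //=.
set D := _ + _.
have cD P : coeff P D = s1 * (P1 == P)%:R + s2 * (P2 == P)%:R.
  rewrite /D coeffD; congr (_ + _);
  by rewrite [LHS](raddfMz (coeff P)) /= coeffU mul1r mulrzz mulrC.
have P12b : P1 == P2 = false by apply/eqP.
have P21b : P2 == P1 = false by rewrite eq_sym.
have H' z : RRspace D z -> z != 0 -> P1 z != - s1 /\ P2 z != - s2.
  move=> [->|zD] z0; first by rewrite eqxx in z0.
  apply: H => //.
  - by have := zD P1; rewrite cD eqxx P21b mulr1 mulr0 addr0; lia.
  - by have := zD P2; rewrite cD eqxx P12b mulr1 mulr0 add0r; lia.
  move=> P PP1 PP2; have := zD P; rewrite cD.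
  rewrite [P1 == P]eq_sym [P2 == P]eq_sym.
  move/eqP/negPf: PP1 => ->; move/eqP/negPf: PP2 => ->.
  by rewrite !mulr0 !addr0.
have cj P P' : coeff P (D - prime_divisor P') = coeff P D - (P' == P)%:R.
  by rewrite coeffB coeffU mul1r.
have key P' : (forall z, RRspace D z -> z != 0 -> P' z != - coeff P' D) ->
    RRspace D = RRspace (D - prime_divisor P').
  move=> HP'; apply/seteqP; split=> z zD; have [->|z0] := eqVneq z 0; try by left.
    right=> P; have := HP' _ zD z0; case: zD => [z00|]; first by rewrite z00 eqxx in z0.
    by move=> /(_ P); rewrite cj; case: (P' =P P) => [->|_] /=; lia.
  case: zD => [z00|zD]; [by left|right => P].
  by have := zD P; rewrite cj; case: (P' =P P) => _ /=; lia.
split; rewrite /ell; congr Kdim; apply: key => z zD z0; rewrite cD eqxx.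
  by rewrite P21b mulr1 mulr0 addr0; case: (H' z).
by rewrite P12b mulr1 mulr0 add0r; case: (H' z).
Qed.

End PlaceTheory.

(** * Places of the rational function field *)

Local Notation "p %:F" := (tofrac p).

Lemma mulrn_int (m : int) n : m *+ n = m * n%:Z.
Proof. by rewrite -mulr_natr natz. Qed.

Lemma ratfunP (K : fieldType) (t : ratfun K) :
  exists n d : {poly K}, d != 0 /\ t = n%:F / d%:F.
Proof.
rewrite -[t]reprK; set r := repr t.
exists (frac r).1, (frac r).2; split; first exact: denom_ratioP.
unlock tofrac; rewrite -[(_)^-1]FracField.pi_inv -[RHS]FracField.pi_mul.
congr (\pi%qT _); rewrite /FracField.mulf /FracField.invf.
by rewrite !numden_Ratio ?oner_eq0 ?denom_ratioP // mul1r mulr1 FracField.Ratio_numden.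
Qed.

Section PolyEmbedding.
Variables (K : fieldType) (F : fieldExtType (ratfun K)).
Local Notation emb a := ((tofrac a)%:A : F).
Implicit Types a b : {poly K}.

Lemma embM a b : emb (a * b) = emb a * emb b.
Proof. by rewrite tofracM [LHS](rmorphM (in_alg F)). Qed.

Lemma embD a b : emb (a + b) = emb a + emb b.
Proof. by rewrite tofracD [LHS](rmorphD (in_alg F)). Qed.

Lemma embB a b : emb (a - b) = emb a - emb b.
Proof. by rewrite tofracB [LHS](rmorphB (in_alg F)). Qed.

Lemma embX a m : emb (a ^+ m) = emb a ^+ m.
Proof. by rewrite tofracXn [LHS](rmorphXn (in_alg F)). Qed.

Lemma emb1 : emb 1 = 1.
Proof. by rewrite tofrac1 scale1r. Qed.

Lemma emb_eq0 a : (emb a == 0) = (a == 0).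
Proof. by rewrite (fmorph_eq0 (in_alg F)) tofrac_eq0. Qed.

Lemma emb_neq0 a : a != 0 -> emb a != 0.
Proof. by rewrite emb_eq0. Qed.

Lemma emb_div a b : (a%:F / b%:F)%:A = emb a / emb b.
Proof. by rewrite [LHS](fmorph_div (in_alg F)). Qed.

End PolyEmbedding.

Section RationalPlaces.
Variables (K : fieldType) (v : place (cst_ratfun K)).
Implicit Types p : {poly K}.

Let tofrac_neq0 p : p != 0 -> p%:F != 0 :> ratfun K.
Proof. by rewrite tofrac_eq0. Qed.

Let place_const c : v (c%:P)%:F = 0.
Proof. exact: (place_cst v c). Qed.

Lemma val_ge_poly p : val_ge v 0 ('X%:F) -> val_ge v 0 (p%:F).
Proof.
move=> vX; elim/poly_ind: p => [|p c IHp]; first by rewrite tofrac0; left.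
rewrite tofracD tofracM; apply: val_geD; first exact: (val_geM IHp vX).
by right; rewrite place_const.
Qed.

Section FiniteZero.
Variable a : K.
Hypothesis va : 0 < v ('X - a%:P)%:F.

Lemma place_nonroot p : ~~ root p a -> v p%:F = 0.
Proof.
move=> pa.
have vX : val_ge v 0 ('X%:F).
  rewrite -[X in X%:F](subrK a%:P) tofracD.
  by apply: val_geD; right; rewrite ?place_const // ltW.
have : root (p - (p.[a])%:P) a by rewrite rootE !hornerE subrr.
case/factor_theorem=> q Eq.
have -> : p = (p.[a])%:P + q * ('X - a%:P) by rewrite -Eq addrC subrK.
have c0 : (p.[a])%:P%:F != 0 :> ratfun K by apply: tofrac_neq0; rewrite polyC_eq0.
have [|_] := @place_dominant _ _ _ v _ (q * ('X - a%:P))%:F c0.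
  rewrite place_const tofracM; apply: val_geM; first exact: val_ge_poly.
  by right; lia.
by rewrite -tofracD place_const.
Qed.

Let place_mup_scaled p : p != 0 -> v p%:F = v ('X - a%:P)%:F *+ mup a p.
Proof.
move=> p0; have [m [q qa Ep]] := multiplicity_XsubC p a.
rewrite p0 /= in qa.
rewrite Ep mupMr // mup_XsubCX eqxx tofracM place_valM; first last.
- by rewrite tofrac_neq0 // expf_neq0 // polyXsubC_eq0.
- by rewrite tofrac_neq0 //; apply: contraNneq qa => ->; rewrite root0.
by rewrite place_nonroot // add0r tofracXn placeX.
Qed.

(** The value group is generated by the value of X - a, and it is Z. *)
Let place_XsubC : v ('X - a%:P)%:F = 1.
Proof.
have [t] := place_onto v; have [n [d [d0 ->]]] := ratfunP t.
have [->|n0] := eqVneq n 0; first by rewrite tofrac0 mul0r place_val0.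
rewrite place_div ?tofrac_neq0 // (place_mup_scaled n0) (place_mup_scaled d0) !mulrn_int -mulrBr.
move: va; set e := v _; set m := (_ - _); move=> e0 em.
have : (e %| 1)%Z by apply/dvdzP; exists m; rewrite mulrC em.
by rewrite dvdz1; lia.
Qed.

Lemma place_mup p : p != 0 -> v p%:F = (mup a p)%:Z.
Proof. by move=> p0; rewrite place_mup_scaled // place_XsubC; lia. Qed.

End FiniteZero.

Section Infinity.
Hypothesis vX_lt0 : v 'X%:F < 0.

Let place_deg_scaled p : p != 0 -> v p%:F = v 'X%:F *+ (size p).-1.
Proof.
move=> p0; have l0 : lead_coef p != 0 by rewrite lead_coef_eq0.
have Ev c n : c != 0 -> v (c *: 'X^n)%:F = v 'X%:F *+ n.
  move=> c0; rewrite -mul_polyC tofracM place_valM ?place_const.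
  - by rewrite add0r tofracXn placeX.
  - by rewrite tofrac_neq0 // polyC_eq0.
  by rewrite tofrac_neq0 // expf_neq0 // polyX_eq0.
have sp : size p = (size p).-1.+1 by rewrite prednK // lt0n size_poly_eq0.
rewrite -{1}[p]coefK poly_def sp big_ord_recr /= -lead_coefE addrC tofracD.
rewrite -(Ev (lead_coef p)) //; apply: (proj2 (place_dominant _ _)).
  by rewrite tofrac_neq0 // scaler_eq0 negb_or l0 expf_neq0 // polyX_eq0.
rewrite raddf_sum; apply: val_ge_sum => i _ /=.
have [->|c0] := eqVneq p`_i 0; first by rewrite scale0r tofrac0; left.
right; rewrite !Ev // !mulrn_int; have := ltn_ord i; nia.
Qed.

Lemma place_deg p : p != 0 -> v p%:F = - ((size p).-1)%:Z.
Proof.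
move=> p0; rewrite place_deg_scaled //.
suff -> : v 'X%:F = -1 by lia.
have [t] := place_onto v; have [n [d [d0 ->]]] := ratfunP t.
have [->|n0] := eqVneq n 0; first by rewrite tofrac0 mul0r place_val0.
rewrite place_div ?tofrac_neq0 // (place_deg_scaled n0) (place_deg_scaled d0) !mulrn_int -mulrBr.
move: vX_lt0; set e := v _; set m := (_ - _); move=> e0 em.
have : (e %| 1)%Z by apply/dvdzP; exists m; rewrite mulrC em.
by rewrite dvdz1; lia.
Qed.

End Infinity.
End RationalPlaces.

Lemma mup_X (K : fieldType) : mup 0 ('X : {poly K}) = 1%N.
Proof. by have := mup_XsubCX 1 (0 : K) 0; rewrite expr1 subr0 eqxx. Qed.

Lemma mup_Xsub1 (K : fieldType) : mup 1 ('X - 1 : {poly K}) = 1%N.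
Proof. by have := mup_XsubCX 1 (1 : K) 1; rewrite expr1 eqxx. Qed.

(** For a polynomial, the zeros at 0 and at 1 are compensated by its pole at
    infinity: the product formula, where the other zeros are dropped. *)
Lemma product_formula_le (K : fieldType) (P0 P1 Pinf : place (cst_ratfun K))
    (p : {poly K}) :
  0 < P0 'X%:F -> 0 < P1 ('X - 1)%:F -> Pinf 'X%:F < 0 -> p != 0 ->
  P0 p%:F + P1 p%:F + Pinf p%:F <= 0.
Proof.
move=> h0 h1 hi p0.
rewrite (place_mup (a := 0)) ?polyC0 ?subr0 // (place_mup (a := 1)) // place_deg //.
set m0 := mup 0 p; set m1 := mup 1 p.
have co : coprimep (('X - 0%:P : {poly K}) ^+ m0) (('X - 1%:P) ^+ m1).
  by apply: coprimep_expl; apply: coprimep_expr; rewrite coprimep_XsubC root_XsubC oner_eq0.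
have : ('X - 0%:P) ^+ m0 * ('X - 1%:P) ^+ m1 %| p.
  by rewrite Gauss_dvdp // -!mup_geq // !leqnn.
move/dvdp_leq => /(_ p0).
rewrite size_mul ?expf_neq0 ?polyXsubC_eq0 // !size_exp_XsubC.
have : (0 < size p)%N by rewrite lt0n size_poly_eq0.
clear; move: (size p) m0 m1 => a m0 m1; lia.
Qed.

(** * Maximal subrings are valuation rings *)

Section ValuationRing.
Variable F : fieldType.
Implicit Types (S O A : set F) (z : F).

Definition is_subring S : Prop :=
  [/\ S 1, forall a b, S a -> S b -> S (a - b) &
      forall a b, S a -> S b -> S (a * b)].

Section SubringClosure.
Variables (S : set F) (Ssub : is_subring S).

Lemma subring1 : S 1. Proof. by case: Ssub. Qed.
Lemma subringB a b : S a -> S b -> S (a - b).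
Proof. by case: Ssub => _ + _; apply. Qed.
Lemma subringM a b : S a -> S b -> S (a * b).
Proof. by case: Ssub => _ _; apply. Qed.
Lemma subring0 : S 0.
Proof. by rewrite -(subrr 1); apply: subringB; exact: subring1. Qed.
Lemma subringN a : S a -> S (- a).
Proof. by move=> Sa; rewrite -sub0r; apply: subringB => //; exact: subring0. Qed.
Lemma subringD a b : S a -> S b -> S (a + b).
Proof. by move=> Sa Sb; rewrite -[b]opprK; apply/subringB/subringN. Qed.
Lemma subringX a n : S a -> S (a ^+ n).
Proof.
move=> Sa; elim: n => [|n IHn]; first exact: subring1.
by rewrite exprS; exact: subringM.
Qed.
Lemma subring_sum (I : Type) (r : seq I) (p : pred I) (a : I -> F) :
  (forall i, S (a i)) -> S (\sum_(i <- r | p i) a i).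
Proof.
by move=> Sa; apply: big_ind => // *; [exact: subring0|exact: subringD].
Qed.

End SubringClosure.

(** Requiring that pi stay a nonunit, rather than that a given ideal stay
    proper, makes the condition pass to unions of chains at once. *)
Lemma exists_maximal_subring A pi :
  is_subring A -> (forall r, A r -> pi * r != 1) ->
  exists O, [/\ is_subring O, A `<=` O, forall r, O r -> pi * r != 1 &
    forall S, is_subring S -> O `<=` S -> (forall r, S r -> pi * r != 1) ->
      S `<=` O].
Proof.
move=> Asub Api.
pose good S := [/\ is_subring S, A `<=` S & forall r, S r -> pi * r != 1].
pose Pz S := S = set0 \/ good S.
have [] := @Zorn_bigcup F Pz.
  move=> C CP Ctot.
  have [C0|/existsNP [S0 /not_implyP [CS0 S00]]] :=
      pselect (forall S, C S -> S = set0).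
    by left; apply/seteqP; split=> // z [S CS Sz]; rewrite -(C0 S CS).
  right.
  have goodC S z : C S -> S z -> good S.
    by move=> CS Sz; case: (CP S CS) => // S0e; rewrite S0e in Sz.
  have gS0 : good S0 by case: (CP _ CS0).
  have join a b : (\bigcup_(X in C) X) a -> (\bigcup_(X in C) X) b ->
      exists S, [/\ C S, good S, S a & S b].
    move=> [S1 CS1 S1a] [S2 CS2 S2b]; case: (Ctot _ _ CS1 CS2) => sub.
      by exists S2; split=> //; [apply: (goodC S2 b)|exact: sub].
    by exists S1; split=> //; [apply: (goodC S1 a)|exact: sub].
  case: (gS0) => S0sub AS0 S0pi; split.
  - split; first by exists S0 => //; exact: subring1.
      move=> a b Ua Ub; have [S [CS [Ssub _ _] Sa Sb]] := join a b Ua Ub.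
      by exists S => //; exact: subringB.
    move=> a b Ua Ub; have [S [CS [Ssub _ _] Sa Sb]] := join a b Ua Ub.
    by exists S => //; exact: subringM.
  - by move=> a Aa; exists S0 => //; exact: AS0.
  by move=> r [S CS Sr]; have [_ _] := goodC S r CS Sr; apply.
move=> O [[->|[Osub AO Opi]] Omax].
  exfalso; apply: (Omax A); last by right; split.
  by split=> // A0; apply: (A0 1); exact: subring1.
exists O; split=> // S Ssub OS Spi; apply: contrapT => nSO.
by apply: (Omax S); [split|right; split=> // z /AO/OS].
Qed.

Section MaximalSubring.
Variables (O : set F) (pi : F).
Hypotheses (Osub : is_subring O) (Opi : O pi).
Hypothesis pi_nonunit : forall r, O r -> pi * r != 1.
Hypothesis Omax : forall S, is_subring S -> O `<=` S ->
  (forall r, S r -> pi * r != 1) -> S `<=` O.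

(** Inverting the elements of 1 + pi O keeps pi a nonunit, so they are already
    invertible in a maximal O. *)
Lemma maximal_subring_inv r : O r -> O (1 - pi * r)^-1.
Proof.
move=> Or.
have den0 b : O b -> 1 - pi * b != 0.
  by move=> Ob; rewrite subr_eq0 eq_sym; exact: pi_nonunit.
pose S : set F := [set w | exists a b, [/\ O a, O b & w = a / (1 - pi * b)]].
have denM b b' : O b -> O b' ->
    exists c, O c /\ (1 - pi * b) * (1 - pi * b') = 1 - pi * c.
  move=> Ob Ob'; exists (b + b' - pi * b * b'); split; last by ring.
  by apply: subringB => //; [exact: subringD|do 2![apply: subringM => //]].
have Oden b : O b -> O (1 - pi * b).
  by move=> Ob; apply: subringB => //; [exact: subring1|exact: subringM].
apply: (Omax (S := S)).
- split.
  + exists 1, 0; split; [exact: subring1|exact: subring0|].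
    by rewrite mulr0 subr0 divr1.
  + move=> _ _ [a [b [Oa Ob ->]]] [a' [b' [Oa' Ob' ->]]].
    have [c [Oc Ec]] := denM b b' Ob Ob'.
    exists (a * (1 - pi * b') - a' * (1 - pi * b)), c; split=> //.
      by apply: subringB => //; apply: subringM => //; exact: Oden.
    by rewrite -Ec; field; rewrite !den0.
  move=> _ _ [a [b [Oa Ob ->]]] [a' [b' [Oa' Ob' ->]]].
  have [c [Oc Ec]] := denM b b' Ob Ob'.
  exists (a * a'), c; split=> //; first exact: subringM.
  by rewrite -Ec; field; rewrite !den0.
- move=> a Oa; exists a, 0; split=> //; first exact: subring0.
  by rewrite mulr0 subr0 divr1.
- move=> _ [a [b [Oa Ob ->]]]; apply/negP => /eqP E.
  have /eqP : pi * (a + b) = 1.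
    have := congr1 (fun t => t * (1 - pi * b)) E.
    rewrite -mulrA divfK ?den0 // mul1r mulrDr => ->; ring.
  by apply/negP/pi_nonunit; exact: subringD.
exists 1, r; split=> //; first exact: subring1.
by rewrite mul1r.
Qed.

(** The degree descent of Chevalley's extension theorem: an expression of the
    shorter kind is solved for its constant term, which makes 1 a combination
    of negative powers; substituting it in the top term of the longer
    expression lowers its degree. *)
Lemma no_double_expression n m z (a b : nat -> F) :
  z != 0 -> (forall i, O (a i)) -> (forall i, O (b i)) ->
  pi * (\sum_(i < n.+1) a i * z ^+ i) = 1 ->
  pi * (\sum_(i < m.+1) b i * z^-1 ^+ i) = 1 -> False.
Proof.
have [k] := ubnP (n + m); elim: k => // k IHk in n m z a b *.
wlog mn : n m z a b / (m <= n)%N => [H|].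
  case: (leqP m n) => [|/ltnW nm]; first exact: H.
  rewrite addnC => lek z0 Oa Ob Ea Eb; apply: (H m n z^-1 b a) => //.
    by rewrite invr_eq0.
  by rewrite invrK.
rewrite ltnS => lek z0 Oa Ob Ea Eb.
have [c Oc Ec] : exists2 c, O c & c * (1 - pi * b 0%N) = 1.
  exists (1 - pi * b 0%N)^-1; first exact: maximal_subring_inv.
  by rewrite mulVf // subr_eq0 eq_sym pi_nonunit.
case: n => [|n] in mn lek Ea *.
  move: Ea; rewrite big_ord_recl big_ord0 addr0 expr0 mulr1 => /eqP.
  exact/negP/pi_nonunit.
pose b' i := if (i <= m)%N then b i else 0.
have Ob' i : O (b' i) by rewrite /b'; case: ifP => // _; exact: subring0.
have Eb' : pi * (\sum_(i < n.+1) b' i.+1 * z^-1 ^+ i.+1) = 1 - pi * b 0%N.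
  have : pi * (\sum_(i < n.+2) b' i * z^-1 ^+ i) = 1.
    rewrite -[RHS]Eb; congr (_ * _).
    rewrite (big_ord_widen_cond n.+2 xpredT (fun i => b i * z^-1 ^+ i)) //.
    rewrite [RHS]big_mkcond /=; apply: eq_bigr => i _.
    by rewrite /b' ltnS; case: ifP => //; rewrite mul0r.
  rewrite big_ord_recl /= expr0 mulr1 mulrDr => E.
  by rewrite -E {1}/b' /= addrC addKr.
have Ez : z ^+ n.+1 =
    c * (pi * (\sum_(i < n.+1) b' (n.+1 - i)%N * z ^+ i)).
  rewrite -[LHS]mul1r -[X in X * _]Ec -!mulrA; congr (_ * _).
  rewrite -Eb' -mulrA mulr_suml; congr (_ * _).
  rewrite (reindex_inj rev_ord_inj) /=; apply: eq_bigr => i _.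
  have lei : (i <= n.+1)%N by exact: ltnW (ltn_ord i).
  have -> : ((n.+1 - i.+1).+1 = n.+1 - i)%N by rewrite subSS subSn // -ltnS.
  rewrite -mulrA -[X in _ * z ^+ X](subnK lei) exprD exprVn mulKf //.
  by rewrite expf_neq0.
apply: (IHk n m z (fun i => a i + a n.+1 * c * pi * b' (n.+1 - i)%N) b) => //.
  move=> i; apply: subringD => //; apply: subringM => //.
  by do 2![apply: subringM => //].
rewrite -[RHS]Ea [in RHS]big_ord_recr /= Ez; congr (_ * _).
under eq_bigr do rewrite mulrDl.
rewrite big_split /=; congr (_ + _).
rewrite !mulr_sumr; apply: eq_bigr => i _; ring.
Qed.

(** If neither z nor its inverse belongs to O, then pi becomes invertible in
    both of the larger rings O[z] and O[1/z], which yields the two expressions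
    excluded by the degree descent. *)
Lemma maximal_subring_valuation z : z != 0 -> O z \/ O z^-1.
Proof.
move=> z0; apply: contrapT => /not_orP [nz nzV].
pose adj w : set F := [set t | exists p : {poly F}, (forall i, O p`_i) /\ t = p.[w]].
have adjsub w : is_subring (adj w).
  split.
  - exists 1; split; last by rewrite hornerC.
    by move=> i; rewrite coef1; case: eqP => _; [exact: subring1|exact: subring0].
  - move=> _ _ [p [Op ->]] [p' [Op' ->]]; exists (p - p').
    by split=> [i|]; rewrite ?hornerD ?hornerN // coefB; exact: subringB.
  move=> _ _ [p [Op ->]] [p' [Op' ->]]; exists (p * p').
  split=> [i|]; rewrite ?hornerM // coefM.
  by apply: subring_sum => // j; exact: subringM.
have Oadj w : O `<=` adj w.
  move=> a Oa; exists a%:P; split; last by rewrite hornerC.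
  by move=> i; rewrite coefC; case: eqP => _ //; exact: subring0.
have adjw w : adj w w.
  exists 'X; split; last by rewrite hornerX.
  by move=> i; rewrite coefX; case: eqP => _; [exact: subring1|exact: subring0].
have bad w : ~ O w -> exists p : {poly F}, (forall i, O p`_i) /\ pi * p.[w] = 1.
  move=> nw; apply: contrapT => H; apply: nw.
  apply: (Omax (adjsub w) (@Oadj w) _ (adjw w)) => _ [p [Op ->]].
  by apply/eqP => E; apply: H; exists p.
have [p [Op Ep]] := bad _ nz; have [p' [Op' Ep']] := bad _ nzV.
apply: (@no_double_expression (size p) (size p') z (fun i => p`_i) (fun i => p'`_i)) => //.
  by rewrite -horner_coef_wide.
by rewrite -horner_coef_wide.
Qed.

End MaximalSubring.
End ValuationRing.

(** * The place of a valuation ring *)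

Section ValuationUnits.
Variables (F : fieldType) (O : set F).
Hypothesis Osub : is_subring O.
Hypothesis Oval : forall z, z != 0 -> O z \/ O z^-1.
Implicit Types z w : F.

Definition vunit : set F := [set z | [/\ z != 0, O z & O z^-1]].

Lemma vunit1 : vunit 1.
Proof. by split; rewrite ?invr1 ?oner_neq0 //; exact: subring1. Qed.

Lemma vunitM z w : vunit z -> vunit w -> vunit (z * w).
Proof.
move=> [z0 Oz OzV] [w0 Ow OwV]; split; first by rewrite mulf_neq0.
  exact: subringM.
by rewrite invfM; exact: subringM.
Qed.

Lemma vunitV z : vunit z -> vunit z^-1.
Proof. by move=> [z0 Oz OzV]; split; rewrite ?invr_eq0 ?invrK. Qed.

Lemma vunitX z n : vunit z -> vunit (z ^+ n).
Proof.
by move=> Uz; elim: n => [|n IHn]; [exact: vunit1|rewrite exprS; exact: vunitM].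
Qed.

(** The nonunits of a valuation ring form an ideal. *)
Lemma vunit_add1 z : O z -> ~ vunit z -> vunit (1 + z).
Proof.
move=> Oz nUz; have O1z : O (1 + z) by apply: subringD => //; exact: subring1.
have [z0|z0] := eqVneq z 0; first by rewrite z0 addr0; exact: vunit1.
have [z1|z1] := eqVneq (1 + z) 0.
  case: nUz; have -> : z = -1 by apply/eqP; rewrite -addr_eq0 addrC z1.
  split; rewrite ?invrN1 ?oppr_eq0 ?oner_eq0 //;
  by apply: subringN => //; exact: subring1.
split=> //; have [//|Oq] : O (1 + z)^-1 \/ O ((1 + z) / z).
  have q0 : (1 + z)^-1 * z != 0 by rewrite mulf_neq0 ?invr_eq0.
  case: (Oval q0) => [Oq|]; last by rewrite invfM invrK => ?; right.
  left; have -> : (1 + z)^-1 = 1 - (1 + z)^-1 * z by field.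
  by apply: subringB => //; exact: subring1.
case: nUz; split=> //.
have -> : z^-1 = (1 + z) / z - 1 by field.
by apply: subringB => //; exact: subring1.
Qed.

(** Terms which are pairwise not associated cannot cancel. *)
Lemma vunit_sum (I : eqType) (r : seq I) (t : I -> F) :
  r != [::] -> uniq r -> (forall i, i \in r -> t i != 0) ->
  (forall i j, i \in r -> j \in r -> i != j -> ~ vunit (t i / t j)) ->
  exists2 i, i \in r & vunit ((\sum_(i <- r) t i) / t i).
Proof.
elim: r => // a r IHr _ /= /andP[ar Ur] t0 nU; rewrite big_cons.
have ta0 : t a != 0 by apply: t0; rewrite inE eqxx.
have [->|r0] := eqVneq r [::].
  exists a; first by rewrite inE.
  by rewrite big_nil addr0 divff //; exact: vunit1.
have [||i ir] := IHr r0 Ur.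
- by move=> i ir; apply: t0; rewrite inE ir orbT.
- by move=> i j ir jr; apply: nU; rewrite inE ?ir ?jr orbT.
set S := \sum_(_ <- _) _ => US.
have ti0 : t i != 0 by apply: t0; rewrite inE ir orbT.
have S0 : S != 0 by move: US => [+ _ _]; rewrite mulf_eq0 negb_or => /andP[].
have nUSa : ~ vunit (S / t a).
  move=> USa; apply: (nU i a); rewrite ?inE ?eqxx ?ir ?orbT //.
    by apply: contraNneq ar => <-.
  have -> : t i / t a = (S / t a) / (S / t i) by field; rewrite ti0 S0.
  by apply/vunitM/vunitV.
have [OSa|OaS] := Oval (mulf_neq0 S0 (invr_neq0 ta0)).
  exists a; first by rewrite inE eqxx.
  by rewrite mulrDl divff //; exact: vunit_add1.
exists i; first by rewrite inE ir orbT.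
have -> : (t a + S) / t i = (1 + (S / t a)^-1) * (S / t i).
  by field; rewrite ?ti0 ?S0 ?ta0.
apply: vunitM => //; apply: vunit_add1 => //.
by move=> /vunitV; rewrite invrK.
Qed.

End ValuationUnits.

Section PlaceOfValuationRing.
Variables (L0 K : fieldType) (F : fieldExtType L0) (iota : {rmorphism K -> F}).
Variables (O : set F) (pi : F).
Implicit Types z t : F.
Hypothesis Osub : is_subring O.
Hypothesis Oval : forall z, z != 0 -> O z \/ O z^-1.
Hypothesis pi0 : pi != 0.
Hypothesis Opi : O pi.
Hypothesis pi_nonunit : forall r, O r -> pi * r != 1.
Hypothesis base_pi_power :
  forall c : L0, c != 0 -> exists m : int, vunit O (c%:A * pi ^ m).
Hypothesis cst_unit : forall c : K, c != 0 -> O (iota c).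

Let U := vunit O.
Let d := \dim {:F}.
Let D := d`!.

(** In a valued extension of degree d, the values of 1, z, ..., z^d cannot be
    pairwise distinct modulo the values of the base field; hence the value
    group is torsion, of bounded exponent, over that of the base. *)
Lemma power_associate z : z != 0 ->
  exists2 e, (0 < e <= d)%N & exists m : int, U (z ^+ e * pi ^ m).
Proof.
move=> z0; pose X := [tuple z ^+ i | i < d.+1].
have : ~~ free X.
  apply/negP; rewrite /free size_tuple => /eqP dX.
  by have := dimvS (subvf <<X>>); rewrite dX -/d ltnn.
have Xi (i : 'I_d.+1) : X`_i = z ^+ i.
  by rewrite (nth_map 0) ?size_enum_ord // nth_ord_enum.
move=> /freeP nf.
have {nf} [k [sk [i0 ki0]]] : exists k : 'I_d.+1 -> L0,
    \sum_i k i *: z ^+ i = 0 /\ exists i, k i != 0.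
  apply: contrapT => H; apply: nf => k Ek i; apply/eqP/negPn/negP => ki.
  apply: H; exists k; split; last by exists i.
  by rewrite -[RHS]Ek; apply: eq_bigr => j _; rewrite Xi.
pose r := [seq i <- enum 'I_d.+1 | k i != 0].
have rP i : (i \in r) = (k i != 0) by rewrite mem_filter mem_enum andbT.
pose t i := k i *: z ^+ i.
have t0 i : i \in r -> t i != 0.
  by rewrite rP => ki; rewrite scaler_eq0 negb_or ki expf_neq0.
have [i [j [ir jr ij Uij]]] : exists i j, [/\ i \in r, j \in r, (i < j)%N & U (t j / t i)].
  apply: contrapT => H.
  have [] := @vunit_sum _ O Osub Oval _ r t.
  - by apply/eqP => r0; have := rP i0; rewrite r0 ki0.
  - by rewrite filter_uniq // enum_uniq.
  - exact: t0.
  - move=> i j ir jr ij Uij; apply: H.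
    case: (ltngtP i j) => [lij|lji|/val_inj E]; last by rewrite E eqxx in ij.
    + by exists i, j; split=> //; rewrite -[t j / t i]invrK invf_div; exact: vunitV.
    + by exists j, i.
  move=> i ir []; rewrite big_filter big_mkcond /=.
  have -> : \sum_(i <- enum 'I_d.+1) (if k i != 0 then t i else 0) = 0.
    rewrite -[RHS]sk big_enum /=; apply: eq_bigr => j _.
    by case: eqP => // kj; rewrite /t kj scale0r.
  by rewrite mul0r eqxx.
exists (j - i)%N; first by rewrite subn_gt0 ij /= (leq_trans (leq_subr _ _)) // -ltnS.
rewrite !rP in ir jr.
have [m Um] := base_pi_power (mulf_neq0 jr (invr_neq0 ir)).
exists (- m); have pim : pi ^ m != 0 by rewrite expfz_neq0.
have -> : z ^+ (j - i) * pi ^ (- m) =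
    t j / t i * ((k j / k i)%:A * pi ^ m)^-1.
  have EA : (k j / k i)%:A = (k j)%:A / (k i)%:A :> F.
    by rewrite [LHS](fmorph_div (in_alg F)).
  have kA l : k l != 0 -> (k l)%:A != 0 :> F.
    by rewrite (fmorph_eq0 (in_alg F)).
  have Et l : t l = (k l)%:A * z ^+ l by rewrite /t mulr_algl.
  rewrite EA !Et -[in RHS](subnK (ltnW ij)) exprD -invr_expz.
  move: (kA _ ir) (kA _ jr) (expf_neq0 i z0) pim.
  move: (_%:A) (_%:A) (z ^+ i) (z ^+ (j - i)) (pi ^ m) => a b c c' e a0 b0 c0 e0.
  by field; rewrite a0 b0 c0 e0.
by apply/vunitM/vunitV.
Qed.

Lemma pi_power_integral (m : int) : O (pi ^ m) -> 0 <= m.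
Proof.
case: m => // n; rewrite NegzE => On; exfalso.
apply: (negP (pi_nonunit (r := pi ^+ n * pi ^ (- n.+1%:Z)) _)).
  by apply: subringM => //; exact: subringX.
by rewrite mulrA -exprS -exprnN divff ?expf_neq0.
Qed.

Lemma value_exists z : z != 0 -> exists m : int, U (z ^+ D * pi ^ (- m)).
Proof.
move=> z0; have [e /andP[e0 ed] [m Um]] := power_associate z0.
have eD : (e %| D)%N by rewrite dvdn_fact // e0.
exists (- (m * (D %/ e)%N)); rewrite opprK.
have := vunitX Osub (D %/ e) Um; rewrite exprMn -exprM mulnC divnK //.
by rewrite -[(pi ^ m) ^+ _]/((pi ^ m) ^ (D %/ e)%N%:Z) -exprz_exp.
Qed.

Let piX (m : int) : pi ^ m != 0. Proof. by rewrite expfz_neq0. Qed.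

(** The value of z, scaled by the exponent d! so as to be an integer. *)
Definition scaled_value z : int :=
  if z == 0 then 0 else xget 0 [set m : int | U (z ^+ D * pi ^ (- m))].

Local Notation w := scaled_value.

Lemma scaled_valueP z : z != 0 -> U (z ^+ D * pi ^ (- w z)).
Proof.
move=> z0; rewrite /scaled_value (negPf z0).
have [m Um] := value_exists z0.
by apply: (@xgetPex _ 0 [set m : int | U (z ^+ D * pi ^ (- m))]); exists m.
Qed.

Lemma scaled_value_eq z m : z != 0 -> U (z ^+ D * pi ^ (- m)) -> w z = m.
Proof.
move=> z0 Um; have Uw := scaled_valueP z0.
have zD : z ^+ D != 0 by rewrite expf_neq0.
have Upow : U (pi ^ (w z - m)).
  have -> : pi ^ (w z - m) = (z ^+ D * pi ^ (- m)) / (z ^+ D * pi ^ (- w z)).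
    rewrite expfzDr // -!invr_expz; move: (piX (w z)) (piX m) zD.
    move: (pi ^ _) (pi ^ _) (z ^+ D) => a b c a0 b0 c0.
    by field; rewrite a0 b0 c0.
  by apply/vunitM/vunitV.
have {}Upow : 0 <= w z - m /\ 0 <= - (w z - m).
  by move: Upow => [_ O1 O2]; split; apply: pi_power_integral; rewrite -?invr_expz.
lia.
Qed.

Lemma scaled_valueM z t : z != 0 -> t != 0 -> w (z * t) = w z + w t.
Proof.
move=> z0 t0; apply: scaled_value_eq; first by rewrite mulf_neq0.
rewrite exprMn opprD expfzDr // mulrACA.
by apply: vunitM => //; exact: scaled_valueP.
Qed.

Lemma scaled_value_unit z : U z -> w z = 0.
Proof.
move=> Uz; have [z0 _ _] := Uz; apply: scaled_value_eq => //.
by rewrite oppr0 expr0z mulr1; exact: vunitX.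
Qed.

Lemma scaled_valueV z : z != 0 -> w z^-1 = - w z.
Proof.
move=> z0; apply/eqP; rewrite -addr_eq0 -scaled_valueM ?invr_eq0 // mulVf //.
by rewrite scaled_value_unit //; exact: vunit1.
Qed.

Lemma scaled_valueXz z (m : int) : z != 0 -> w (z ^ m) = m * w z.
Proof.
move=> z0; have wX n : w (z ^+ n) = n%:Z * w z.
  elim: n => [|n IHn].
    by rewrite expr0 mul0r scaled_value_unit //; exact: vunit1.
  by rewrite exprS scaled_valueM ?expf_neq0 // IHn; lia.
case: m => n; first exact: wX.
by rewrite NegzE -exprnN scaled_valueV ?expf_neq0 // wX mulNr.
Qed.

Lemma scaled_value_ge0 z : z != 0 -> O z -> 0 <= w z.
Proof.
move=> z0 Oz; apply: pi_power_integral.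
have -> : pi ^ w z = z ^+ D * (z ^+ D * pi ^ (- w z))^-1.
  by rewrite invfM mulrA divff ?expf_neq0 // mul1r invr_expz opprK.
apply: subringM => //; first exact: subringX.
by case: (scaled_valueP z0).
Qed.

Lemma scaled_valueD z t : z != 0 -> t != 0 -> z + t != 0 ->
  Num.min (w z) (w t) <= w (z + t).
Proof.
wlog Otz : z t / O (t / z) => [H z0 t0 zt0|z0 t0 zt0].
  have [|] := Oval (mulf_neq0 t0 (invr_neq0 z0)); first by move=> ?; exact: H.
  by rewrite invf_div minC addrC => ?; apply: H => //; rewrite addrC.
have E : z + t = z * (1 + t / z) by field.
have q0 : 1 + t / z != 0 by apply: contraNneq zt0 => q0; rewrite E q0 mulr0.
rewrite ge_min E scaled_valueM // lerDl scaled_value_ge0 //.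
by apply: subringD => //; exact: subring1.
Qed.

Lemma scaled_value_pi : w pi = D.
Proof.
apply: scaled_value_eq => //; rewrite -exprnN divff ?expf_neq0 //.
exact: vunit1.
Qed.

(** The scaled values form a nonzero subgroup of Z; the place is the scaled
    value divided by the positive generator e of this subgroup. *)
Lemma place_of_valuation_ring :
  exists P : place iota, 0 < P pi /\ forall z, z != 0 -> O z -> 0 <= P z.
Proof.
have posP : exists n, (0 < n)%N && `[< exists2 z : F, z != 0 & w z = n%:Z >].
  exists D; rewrite fact_gt0; apply/asboolP; exists pi => //.
  exact: scaled_value_pi.
case: (ex_minnP posP) => e /andP[e0 /asboolP[z0 z00 wz0]] emin.
have ew z : (e %| w z)%Z.
  have [->|zn0] := eqVneq z 0; first by rewrite /scaled_value eqxx dvdz0.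
  apply/dvdz_mod0P/eqP/negPn/negP => r0.
  have rge0 : 0 <= (w z %% e)%Z by apply: modz_ge0; lia.
  have rlt : (w z %% e)%Z < e by apply: ltz_pmod; lia.
  have := emin (absz (w z %% e)%Z).
  suff -> : (0 < absz (w z %% e)%Z)%N && `[< exists2 t : F, t != 0 &
      w t = (absz (w z %% e)%Z)%:Z >] by move=> /(_ isT); lia.
  rewrite absz_gt0 r0 /=; apply/asboolP.
  exists (z * z0 ^ (- (w z %/ e)%Z)); first by rewrite mulf_neq0 // expfz_neq0.
  rewrite scaled_valueM ?expfz_neq0 // scaled_valueXz // wz0 gez0_abs //.
  by rewrite {1}(divz_eq (w z) e); lia.
pose v z := (w z %/ e)%Z.
have ve z : w z = v z * e by rewrite /v divzK.
have w0 : w 0 = 0 by rewrite /scaled_value eqxx.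
have eP : 0 < e%:Z by lia.
have v0 : v 0 = 0 by rewrite /v w0 div0z.
have vM z t : z != 0 -> t != 0 -> v (z * t) = v z + v t.
  move=> zn0 tn0; have := scaled_valueM zn0 tn0; rewrite !ve -mulrDl => /mulIf.
  by apply; lia.
have vD z t : z != 0 -> t != 0 -> z + t != 0 -> Num.min (v z) (v t) <= v (z + t).
  move=> zn0 tn0 ztn0; have := scaled_valueD zn0 tn0 ztn0.
  by rewrite !ve !ge_min !ler_pM2r.
have vc c : v (iota c) = 0.
  have [->|c0] := eqVneq c 0; first by rewrite rmorph0.
  rewrite /v scaled_value_unit ?div0z //; split; rewrite ?fmorph_eq0 -?fmorphV //;
  by apply: cst_unit; rewrite ?invr_eq0.
have vo : exists t, v t = 1.
  by exists z0; rewrite /v wz0 divzz; case: eqP eP => // ->.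
exists (Place v0 vM vD vc vo) => /=; split.
  by rewrite -(ltr_pM2r eP) -ve mul0r scaled_value_pi ltz_nat fact_gt0.
by move=> z zn0 Oz; rewrite -(ler_pM2r eP) -ve mul0r scaled_value_ge0.
Qed.

End PlaceOfValuationRing.

(** * Places over an irreducible polynomial *)

Section PlaceOverIrreducible.
Variables (K : fieldType) (F : fieldExtType (ratfun K)).
Variable p : {poly K}.
Hypothesis irr_p : irreducible_poly p.

Lemma irredp_ndvdM q r : ~~ (p %| q) -> ~~ (p %| r) -> ~~ (p %| q * r).
Proof. by move=> pq pr; rewrite Gauss_dvdpr // irreducible_poly_coprime. Qed.

Lemma irredp_factor q : q != 0 ->
  exists m q', q = p ^+ m * q' /\ ~~ (p %| q').
Proof.
have [sp _] := irr_p.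
have p0 : p != 0 by rewrite -size_poly_gt0 ltnW.
have [k] := ubnP (size q); elim: k q => // k IHk q; rewrite ltnS => sq q0.
have [pq|npq] := boolP (p %| q); last by exists 0%N, q; rewrite expr0 mul1r.
have Eq := divpK pq; have q'0 : q %/ p != 0.
  by apply: contraNneq q0 => e0; rewrite -Eq e0 mul0r.
have [|//|m [q' [E np]]] := IHk (q %/ p).
  rewrite size_divp //; apply: leq_trans sq; move: sp q0.
  by rewrite -size_poly_gt0; move: (size p) (size q); lia.
by exists m.+1, q'; split=> //; rewrite -Eq E exprS; ring.
Qed.

Local Notation emb a := ((tofrac a)%:A : F).

(** A maximal subring containing the local ring A of K[x] at p. The
    multiplicative group of K(x) is generated by p and the units of A, so that the
    value of p generates the values of K(x). *)
Lemma exists_place_over : exists P : place (cst_ext F),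
  0 < P (emb p) /\ forall a, ~~ (p %| a) -> P (emb a) = 0.
Proof.
have [sp _] := irr_p.
have p0 : p != 0 by rewrite -size_poly_gt0 ltnW.
have nd0 a : ~~ (p %| a) -> emb a != 0.
  by rewrite emb_eq0; apply: contraNneq => ->; rewrite dvdp0.
have np1 : ~~ (p %| 1) by rewrite dvdp1; lia.
pose A : set F := [set z | exists a b, ~~ (p %| b) /\ z = emb a / emb b].
have embA a : A (emb a) by exists a, 1; rewrite emb1 divr1.
have Asub : is_subring A.
  split; first by rewrite -emb1.
    move=> _ _ [a [b [nb ->]]] [a' [b' [nb' ->]]].
    exists (a * b' - a' * b), (b * b'); split; first exact: irredp_ndvdM.
    rewrite embB !embM; move: (nd0 _ nb) (nd0 _ nb').
    move: (emb a) (emb b) (emb a') (emb b') => x y z t y0 t0.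
    by field; rewrite y0 t0.
  move=> _ _ [a [b [nb ->]]] [a' [b' [nb' ->]]].
  exists (a * a'), (b * b'); split; first exact: irredp_ndvdM.
  by rewrite !embM invfM mulrACA.
have Api r : A r -> emb p * r != 1.
  move=> [a [b [nb ->]]]; apply/negP => /eqP E.
  have : emb (p * a - b) == 0.
    have /= := congr1 ( *%R^~ (emb b)) E; rewrite mul1r mulrA divfK ?nd0 //.
    by rewrite embB embM => ->; rewrite subrr.
  rewrite emb_eq0 subr_eq0 => /eqP Eb.
  by rewrite -Eb dvdp_mulr in nb.
have [O [Osub AO Opi Omax]] := exists_maximal_subring Asub Api.
have OA a : O (emb a) by exact/AO.
have Oval := maximal_subring_valuation Osub (OA p) Opi Omax.
have Uemb a : ~~ (p %| a) -> vunit O (emb a).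
  move=> na; split=> //; first exact: nd0.
  by apply: AO; exists 1, a; rewrite emb1 mul1r.
have base c : c != 0 -> exists m : int, vunit O (c%:A * emb p ^ m).
  have [n [d [d0 ->]]] := ratfunP c => c0.
  have n0 : n != 0.
    by apply: contraNneq c0 => ->; rewrite tofrac0 mul0r.
  have [i [n' [En nn']]] := irredp_factor n0.
  have [j [d' [Ed nd']]] := irredp_factor d0.
  exists (j%:Z - i%:Z).
  have -> : (n%:F / d%:F)%:A * emb p ^ (j%:Z - i%:Z) = emb n' / emb d'.
    have pe0 : emb p != 0 by rewrite emb_eq0.
    rewrite emb_div En Ed !embM !embX expfzDr // -exprnN -[emb p ^ j]/(emb p ^+ j).
    move: (expf_neq0 i pe0) (expf_neq0 j pe0) (nd0 _ nd').
    move: (emb p ^+ i) (emb p ^+ j) (emb n') (emb d') => x y z t x0 y0 t0.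
    by field; rewrite x0 y0 t0.
  by apply: (vunitM Osub); [exact: Uemb|apply/vunitV/Uemb].
have cstU c : c != 0 -> O (cst_ext F c) by move=> _; exact: OA.
have pe0 : emb p != 0 by rewrite emb_eq0.
have [P [Pp PO]] := place_of_valuation_ring Osub Oval pe0 (OA p) Opi base cstU.
exists P; split=> // a na; apply/eqP; rewrite eq_le.
have [a0 Oa OaV] := Uemb a na.
by rewrite -oppr_ge0 -placeV !PO // invr_eq0.
Qed.

End PlaceOverIrreducible.

(** * Kummer extensions *)

Section PlaceAut.
Variables (K L0 : fieldType) (F : fieldExtType L0) (iota : {rmorphism K -> F}).
Variables (P : place iota) (sigma : 'AEnd(F)).
Hypothesis sigma_cst : forall c : K, sigma (iota c) = iota c.

Lemma place_aut : exists P' : place iota, forall z, P' z = P (sigma z).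
Proof.
have v0 : P (sigma 0) = 0 by rewrite rmorph0 place_val0.
have vM z w : z != 0 -> w != 0 -> P (sigma (z * w)) = P (sigma z) + P (sigma w).
  by move=> z0 w0; rewrite rmorphM place_valM // fmorph_eq0.
have vD z w : z != 0 -> w != 0 -> z + w != 0 ->
    Num.min (P (sigma z)) (P (sigma w)) <= P (sigma (z + w)).
  by move=> z0 w0 zw0; rewrite rmorphD place_valD -?rmorphD // fmorph_eq0.
have vc c : P (sigma (iota c)) = 0 by rewrite sigma_cst place_cst.
have vo : exists t, P (sigma t) = 1.
  have [t Pt] := place_onto P.
  have : t \in (limg sigma) by rewrite (lker0_limgf (AEnd_lker0 _)) memvf.
  by case/memv_imgP => t' _ Et; exists t'; rewrite -Et.
by exists (Place v0 vM vD vc vo).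
Qed.

End PlaceAut.

Section Kummer.
Variables (L0 : fieldType) (F : fieldExtType L0) (N : nat) (h : L0) (y : F).
Hypothesis N0 : (0 < N)%N.
Hypothesis yN : y ^+ N = h%:A.
Hypothesis Fy : <<1; y>>%VS = fullv.

Lemma kummer_adjoin_degree : adjoin_degree 1 y = \dim {:F}.
Proof. by rewrite adjoin_degreeE Fy /= dimv1 divn1. Qed.

Let kummer_polyOver : 'X^N - (h%:A)%:P \is a polyOver (1%VS : {vspace F}).
Proof.
by rewrite rpredB ?rpredX ?polyOverX // polyOverC; apply/vlineP; exists h.
Qed.

Lemma kummer_minPoly_dvd : minPoly 1 y %| 'X^N - (h%:A)%:P.
Proof.
apply: minPoly_dvdp kummer_polyOver _.
by rewrite rootE !hornerE yN subrr.
Qed.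

Lemma kummer_dim_le : (\dim {:F} <= N)%N.
Proof.
rewrite -kummer_adjoin_degree.
have := dvdp_leq (monic_neq0 (monicXnsubC (h%:A) N0)) kummer_minPoly_dvd.
by rewrite size_minPoly size_XnsubC.
Qed.

Hypothesis dimF : \dim {:F} = N.

Lemma kummer_minPoly : minPoly 1 y = 'X^N - (h%:A)%:P.
Proof.
apply/eqP; rewrite -eqp_monic ?monic_minPoly ?monicXnsubC //.
rewrite -dvdp_size_eqp ?kummer_minPoly_dvd //.
by rewrite size_minPoly size_XnsubC // kummer_adjoin_degree dimF.
Qed.

Lemma kummer_decomposition z :
  exists g : 'I_N -> L0, z = \sum_(k < N) (g k)%:A * y ^+ k.
Proof.
set p := Fadjoin_poly 1 y z.
have sp : (size p <= N)%N.
  by rewrite -dimF -kummer_adjoin_degree size_Fadjoin_poly.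
have c1 (k : 'I_N) : {c | p`_k = c%:A}.
  apply: cid; apply/vlineP; have /polyOverP := Fadjoin_polyOver 1%AS y z.
  exact.
exists (fun k => sval (c1 k)); have zF : z \in <<1; y>>%VS by rewrite Fy memvf.
rewrite -{1}(Fadjoin_poly_eq zF) (horner_coef_wide _ sp).
by apply: eq_bigr => k _; case: (c1 k) => c /= ->.
Qed.

(** The minimal polynomial of y is 'X^N - h, and w y is another root. *)
Lemma kummer_aut (w : L0) : w ^+ N = 1 ->
  exists sigma : 'AEnd(F), sigma y = w%:A * y.
Proof.
move=> wN; set y' := w%:A * y.
have root_y' : root (map_poly (\1%VF : 'End(F)) (minPoly 1 y)) y'.
  have -> : map_poly (\1%VF : 'End(F)) (minPoly 1 y) = minPoly 1 y.
    by apply: map_poly_id => c _; rewrite id_lfunE.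
  rewrite kummer_minPoly rootE !hornerE exprMn yN.
  have -> : (w%:A : F) ^+ N = 1.
    by rewrite -[LHS](rmorphXn (in_alg F)) wN /= scale1r.
  by rewrite mul1r subrr.
have homf := kHomExtendP (subvv _) (kHom1 1 1) root_y'.
rewrite Fy k1HomE in homf.
by exists (AHom homf) => /=; exact: (kHomExtend_val (kHom1 1 1) root_y').
Qed.

End Kummer.

Lemma sum_prim_root_powers (K : fieldType) (N : nat) (zeta : K) (k l : 'I_N) :
  N.-primitive_root zeta ->
  \sum_(i < N) (zeta ^+ l / zeta ^+ k) ^+ i = (l == k)%:R * N%:R.
Proof.
move=> zP; have N0 := prim_order_gt0 zP.
have z0 : zeta != 0 by rewrite (prim_root_eq0 zP) -lt0n.
have [->|lk] := eqVneq l k.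
  rewrite divff ?expf_neq0 // mul1r.
  by under eq_bigr do rewrite expr1n; rewrite sumr_const card_ord.
rewrite mul0r; set w := _ / _.
have w1 : w - 1 != 0.
  rewrite subr_eq0; apply: contraNneq lk => w1.
  have : zeta ^+ l == zeta ^+ k by rewrite -(divfK (expf_neq0 k z0) (zeta ^+ l)) -/w w1 mul1r.
  by rewrite (eq_prim_root_expr zP) !modn_small.
apply: (mulfI w1); rewrite mulr0 -subrX1 /w expr_div_n -!exprM.
by rewrite ![(_ * N)%N]mulnC !exprM (prim_expr_order zP) !expr1n divr1 subrr.
Qed.

Section KummerPlaces.
Variables (K L0 : fieldType) (iota0 : {rmorphism K -> L0}).
Variables (F : fieldExtType L0) (iota : {rmorphism K -> F}).
Hypothesis iotaE : forall c, iota c = (iota0 c)%:A.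
Variables (N : nat) (h : L0) (y : F) (zeta : K).
Hypothesis yN : y ^+ N = h%:A.
Hypothesis Fy : <<1; y>>%VS = fullv.
Hypothesis dimF : \dim {:F} = N.
Hypothesis zetaP : N.-primitive_root zeta.
Hypothesis N_neq0 : N%:R != 0 :> K.
Hypothesis y0 : y != 0.

Let N0 : (0 < N)%N. Proof. exact: prim_order_gt0 zetaP. Qed.

Let term (g : 'I_N -> L0) k : F := (g k)%:A * y ^+ k.

(** Averaging the conjugates of z against a character of the Galois group
    extracts one component of z. *)
Lemma kummer_average (P : place iota) (g : 'I_N -> L0) k :
  (forall sigma : 'AEnd(F), val_ge P 0 (sigma (\sum_k term g k))) ->
  val_ge P 0 (term g k).
Proof.
move=> Psigma.
have sigmaP i : {sigma : 'AEnd(F) | sigma y = iota (zeta ^+ i) * y}.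
  apply: cid; rewrite iotaE; apply: (@kummer_aut _ _ N h y N0 yN Fy dimF (iota0 (zeta ^+ i))).
  by rewrite -rmorphXn -exprM mulnC exprM (prim_expr_order zetaP) expr1n rmorph1.
have E : term g k = iota N%:R^-1 *
    \sum_(i < N) iota ((zeta ^+ k) ^- i) *
      sval (sigmaP i) (\sum_k term g k).
  have Es (i : 'I_N) : iota ((zeta ^+ k) ^- i) * sval (sigmaP i) (\sum_k term g k) =
      \sum_(l < N) iota ((zeta ^+ l / zeta ^+ k) ^+ i) * term g l.
    rewrite rmorph_sum mulr_sumr; apply: eq_bigr => l _ /=.
    case: (sigmaP i) => s /= sy.
    have -> : s (term g l) = (g l)%:A * (iota (zeta ^+ i) * y) ^+ l.
      by rewrite /term rmorphM /= [s (y ^+ l)]rmorphXn /= sy linearZ /= rmorph1.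
    have -> : (zeta ^+ l / zeta ^+ k) ^+ i = (zeta ^+ i) ^+ l * (zeta ^+ k) ^- i.
      by rewrite expr_div_n -!exprM mulnC.
    rewrite /term exprMn -(rmorphXn iota) (rmorphM iota).
    move: (iota _) (iota _) (_%:A) (y ^+ l) => a b c e; ring.
  rewrite (eq_bigr _ (fun i _ => Es i)) exchange_big /=.
  under eq_bigr => l _ do
    rewrite -mulr_suml -(rmorph_sum iota) /= sum_prim_root_powers //.
  rewrite (bigD1 k) //= eqxx mul1r big1 ?addr0; last first.
    by move=> l lk; rewrite (negPf lk) mul0r (rmorph0 iota) mul0r.
  by rewrite mulrA -(rmorphM iota) mulVf // (rmorph1 iota) mul1r.
rewrite E -[0]addr0; apply: val_geM; first exact: val_ge_cst.
apply: val_ge_sum => i _; rewrite -[0]addr0; apply: val_geM => //.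
exact: val_ge_cst.
Qed.

Definition kummer_ramified (T : place iota) : Prop :=
  coprimez (T y) N /\
  exists v : place iota0, forall f, T f%:A = v f *+ N.

(** At a totally ramified place, the components of z in the basis of powers
    of y have values in distinct classes modulo the degree. *)
Lemma kummer_component (T : place iota) z :
  kummer_ramified T -> z != 0 ->
  exists (k : nat) (g : L0),
    [/\ (k < N)%N, g != 0, T (g%:A * y ^+ k) = T z,
        forall T', kummer_ramified T' -> T' z <= T' (g%:A * y ^+ k)
      & forall P : place iota,
          (forall sigma : 'AEnd(F), val_ge P 0 (sigma z)) ->
          0 <= P (g%:A * y ^+ k)].
Proof.
have [g ->] := kummer_decomposition Fy dimF z.
rewrite -/(term g) => Tram s0.
have gt0 k : term g k != 0 -> g k != 0.
  by apply: contraNneq => gk; rewrite /term gk scale0r mul0r.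
have inj T' : kummer_ramified T' -> forall k l, term g k != 0 -> term g l != 0 ->
    T' (term g k) = T' (term g l) -> k = l.
  move=> [co [v Tv]] k l /gt0 gk /gt0 gl.
  rewrite /term !place_valM ?expf_neq0 ?(fmorph_eq0 (in_alg F)) //.
  rewrite !Tv !placeX !mulrn_int => E.
  have : (N %| (T' y) * (k%:Z - l%:Z))%Z.
    by apply/dvdzP; exists (v (g l) - v (g k)); lia.
  rewrite mulrC Gauss_dvdzl; last by rewrite coprimez_sym.
  move=> /dvdzP[m Em]; apply/val_inj => /=.
  have [lk ll] := (ltn_ord k, ltn_ord l).
  have m0 : m = 0 by move: Em lk ll; clear; nia.
  by move: Em; rewrite m0; lia.
have [k0 gk0] : exists k, term g k != 0.
  apply/existsP; apply: contraNT s0; rewrite negb_exists => /forallP g0.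
  by rewrite big1 // => k _; apply/eqP; have := g0 k; rewrite negbK.
have [k [gk _ Ek _]] := place_sum_distinct (inj T Tram) gk0.
exists k, (g k); split=> //; first exact: gt0.
  move=> T' T'ram; have [k' [_ _ -> lek']] := place_sum_distinct (inj T' T'ram) gk0.
  exact: lek'.
move=> P /(@kummer_average P g k) [t0|//].
by rewrite t0 eqxx in gk.
Qed.

End KummerPlaces.

(** * Orders of the coefficient of a monomial *)

Section PolyFactors.
Variable K : fieldType.
Implicit Types p d : {poly K}.

Lemma exists_irreducible_factor d :
  (1 < size d)%N -> exists2 p, irreducible_poly p & p %| d.
Proof.
have [k] := ubnP (size d); elim: k d => // k IHk d; rewrite ltnS => dk d1.
have [irr|] := pselect (irreducible_poly d); first by exists d.
move=> /not_andP[//|/existsNP[p /not_implyP[p1 /not_implyP[pd npd]]]].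
have d0 : d != 0 by rewrite -size_poly_gt0 ltnW.
have p0 : p != 0 by apply: contraNneq d0 => p0; rewrite p0 dvd0p in pd.
have lepd : (size p < size d)%N.
  by rewrite ltn_neqAle dvdp_leq // andbT dvdp_size_eqp //; apply/negP.
have [||r irr rp] := IHk p; first exact: leq_trans dk.
  by move: p1; rewrite -size_poly_gt0 in p0; move: (size p) p0; lia.
by exists r => //; exact: dvdp_trans pd.
Qed.

Lemma dvdp_exp_of_irreducible d e : d != 0 ->
  (forall p, irreducible_poly p -> p %| d -> p %| e) -> d %| e ^+ size d.
Proof.
have [k] := ubnP (size d); elim: k d => // k IHk d; rewrite ltnS => dk d0 H.
have [s1|] := leqP (size d) 1.
  have : size d == 1 by rewrite eqn_leq s1 size_poly_gt0.
  by rewrite size_poly_eq1 => /eqp_dvdl ->; rewrite dvd1p.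
move=> /exists_irreducible_factor[p irr pd].
have [sp _] := irr; have Ed := divpK pd.
have d'0 : d %/ p != 0 by apply: contraNneq d0 => e0; rewrite -Ed e0 mul0r.
have sd' : (size (d %/ p)%R < size d)%N.
  rewrite size_divp; last by rewrite irredp_neq0.
  by move: d0; rewrite -size_poly_gt0; move: (size p) (size d) sp; lia.
have := IHk _ (leq_trans sd' dk) d'0 => /(_ _)/= d'e.
rewrite -{1}Ed (dvdp_trans (dvdp_mul (d'e _) (H p irr pd))) //.
  by move=> r rirr rd; apply: H => //; rewrite -Ed; exact: dvdp_mulr.
by rewrite -exprSr dvdp_exp2l.
Qed.

End PolyFactors.

Section ComponentBound.
Variables (K : fieldType) (F : fieldExtType (ratfun K)).
Variables (s t k : nat) (f : {poly K}) (y : F) (g : ratfun K).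
Local Notation emb a := ((tofrac a)%:A : F).
Hypothesis s0 : (0 < s)%N.
Hypothesis t0 : (0 < t)%N.
Hypothesis f_sqfree : forall p, irreducible_poly p -> ~~ (p * p %| f).
Hypothesis f_root0 : ~~ root f 0.
Hypothesis f_root1 : ~~ root f 1.
Hypothesis yN : y ^+ (s * t) = emb ('X * ('X - 1) * f ^+ t).
Hypothesis y0 : y != 0.
Hypothesis g0 : g != 0.
Hypothesis regular : forall P : place (cst_ext F),
  P (emb 'X) = 0 -> P (emb ('X - 1)) = 0 -> 0 <= P (g%:A * y ^+ k).

Let j := (k %/ s)%N.
Let e : {poly K} := 'X * ('X - 1).

Let f0 : f != 0.
Proof. by apply: contraNneq f_root0 => ->; rewrite root0. Qed.

(** The ramification bound: at a zero of f the function y has a zero, whose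
    order is the ramification index divided by s; hence a pole of g there, which
    the zero of y ^+ k must cancel, has order at most k %/ s. Elsewhere in the
    affine line, 0 and 1 excepted, g has no pole. *)
Lemma pole_only_at_01 (n d p : {poly K}) :
  n != 0 -> d != 0 -> coprimep n d -> g * (f ^+ j)%:F = n%:F / d%:F ->
  irreducible_poly p -> p %| d -> p %| e.
Proof.
move=> n0 d0 co E irr pd; apply/negPn/negP => npe.
have p0 := irredp_neq0 irr.
have [P [Pp Pu]] := exists_place_over F irr.
have Ppoly a : a != 0 -> 0 <= P (emb a).
  move=> a0; have [m [a' [-> na']]] := irredp_factor irr a0.
  have a'0 : a' != 0 by apply: contraNneq na' => ->; rewrite dvdp0.
  rewrite embM place_valM ?emb_neq0 ?expf_neq0 // (Pu a') // addr0 embX placeX.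
  by rewrite mulrn_wge0 // ltW.
have npn : ~~ (p %| n).
  by rewrite -irreducible_poly_coprime // (coprimep_dvdr pd) // coprimep_sym.
have PX : P (emb 'X) = 0.
  by apply: Pu; apply: contraNN npe => pX; rewrite dvdp_mulr.
have PX1 : P (emb ('X - 1)) = 0.
  by apply: Pu; apply: contraNN npe => pX; rewrite dvdp_mull.
have gA0 : (g%:A : F) != 0 by rewrite (fmorph_eq0 (in_alg F)).
have := regular PX PX1; rewrite place_valM ?expf_neq0 // placeX.
have Py : P y *+ s = P (emb f).
  have X0 : ('X : {poly K}) != 0 by rewrite polyX_eq0.
  have X10 : ('X - 1 : {poly K}) != 0 by rewrite polyXsubC_eq0.
  have := placeX P y (s * t); rewrite yN !embM embX !place_valM; last first.
  all: try by rewrite ?mulf_neq0 ?expf_neq0 ?emb_neq0.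
  rewrite PX PX1 !add0r placeX mulrnA !mulrn_int => /esym/mulIf; apply.
  by move: t0; clear; lia.
have PG : P (g%:A) + P (emb f) *+ j <= - P (emb p).
  have -> : P (g%:A) + P (emb f) *+ j = P (emb n / emb d).
    rewrite -emb_div; have -> : (n%:F / d%:F)%:A = g%:A * emb (f ^+ j).
      by rewrite -E [LHS](rmorphM (in_alg F)).
    by rewrite place_valM ?emb_neq0 ?expf_neq0 // embX placeX.
  rewrite place_div ?emb_neq0 // (Pu n) // add0r lerN2 -(divpK pd) embM.
  have d'0 : d %/ p != 0 by apply: contraNneq d0 => e0; rewrite -(divpK pd) e0 mul0r.
  by rewrite place_valM ?emb_neq0 // lerDr Ppoly.
have Pf : 0 <= P (emb f) <= P (emb p).
  rewrite Ppoly //=; have [pf|npf] := boolP (p %| f); last by rewrite Pu // ltW.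
  rewrite -(divpK pf) embM.
  have f'0 : f %/ p != 0 by apply: contraNneq f0 => e0; rewrite -(divpK pf) e0 mul0r.
  rewrite place_valM ?emb_neq0 // (Pu (f %/ p)) ?add0r //.
  apply: contraNN (f_sqfree irr) => pf'.
  by rewrite -(divpK pf) dvdp_mul.
have kj : (k < j.+1 * s)%N by rewrite ltn_ceil.
move: Py PG Pf kj Pp; rewrite !mulrn_int.
move: (P y) (P (emb f)) (P (emb p)) (P g%:A) => a b c u.
clear -s0; nia.
Qed.

(** Multiplying g by f^j and by a large power of X (X - 1) yields a polynomial C,
    to which the product formula applies. The power of X (X - 1) does not
    contribute, having total order zero at 0, 1 and infinity. *)
Lemma component_bound (P0 P1 Pinf : place (cst_ratfun K)) :
  0 < P0 'X%:F -> 0 < P1 ('X - 1)%:F -> Pinf 'X%:F < 0 ->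
  P0 g + P1 g + Pinf g <= (j * (size f).-1)%N%:Z.
Proof.
move=> h0 h1 hi.
have fF0 a : a != 0 -> a%:F != 0 :> ratfun K by rewrite tofrac_eq0.
have [n1 [d1 [d10 E1]]] := ratfunP (g * (f ^+ j)%:F).
have G0 : g * (f ^+ j)%:F != 0 by rewrite mulf_neq0 ?fF0 ?expf_neq0.
have n10 : n1 != 0 by apply: contraNneq G0 => n10; rewrite E1 n10 tofrac0 mul0r.
pose n := n1 %/ gcdp n1 d1; pose d := d1 %/ gcdp n1 d1.
have En : n1 = n * gcdp n1 d1 by rewrite divpK // dvdp_gcdl.
have Ed : d1 = d * gcdp n1 d1 by rewrite divpK // dvdp_gcdr.
have c0 : gcdp n1 d1 != 0 by rewrite gcdp_eq0 negb_and n10.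
have n0 : n != 0 by apply: contraNneq n10 => n0; rewrite En n0 mul0r.
have d0 : d != 0 by apply: contraNneq d10 => d0; rewrite Ed d0 mul0r.
have co : coprimep n d by rewrite coprimep_div_gcd // n10.
have E : g * (f ^+ j)%:F = n%:F / d%:F.
  by rewrite E1 {1}En {2}Ed !tofracM -mulf_div divff ?mulr1 ?fF0.
have := dvdp_exp_of_irreducible d0 (fun p irr pd => pole_only_at_01 n0 d0 co E irr pd).
set M := size d; move=> dM; pose C := n * (e ^+ M %/ d).
have e0 : e != 0 by rewrite mulf_neq0 ?polyX_eq0 ?polyXsubC_eq0.
have EC : C%:F = g * f%:F ^+ j * e%:F ^+ M.
  rewrite -!tofracXn E -[e ^+ M](divpK dM) /C !tofracM -mulrA.
  by rewrite [X in _ = _ * (_ * X)]mulrC mulKf ?fF0 // divpK.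
have C0 : C != 0.
  apply: mulf_neq0 => //; apply/eqP => c0'.
  by have := expf_neq0 M e0; rewrite -(divpK dM) c0' mul0r eqxx.
have := product_formula_le h0 h1 hi C0.
have X0 : ('X : {poly K}) != 0 by rewrite polyX_eq0.
have X10 : ('X - 1 : {poly K}) != 0 by rewrite polyXsubC_eq0.
have PC (P : place (cst_ratfun K)) :
    P C%:F = P g + P f%:F *+ j + (P 'X%:F + P ('X - 1)%:F) *+ M.
  have fj0 := expf_neq0 j (fF0 _ f0); have eM0 := expf_neq0 M (fF0 _ e0).
  rewrite EC (place_valM P (mulf_neq0 g0 fj0) eM0) (place_valM P g0 fj0).
  rewrite (placeX P f%:F j) (placeX P e%:F M) /e (tofracM 'X ('X - 1)).
  by rewrite (place_valM P (fF0 _ X0) (fF0 _ X10)).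
have h0' : 0 < P0 ('X - 0%:P)%:F by rewrite subr0.
rewrite !PC !(place_mup h0') // !(place_mup (a := 1) h1) // !(place_deg hi) //.
rewrite mup_X mup_Xsub1 (mupNroot f_root0) (mupNroot f_root1).
rewrite (@mupNroot _ 0 ('X - 1)) ?root_XsubC 1?eq_sym ?oner_eq0 //.
rewrite (@mupNroot _ 1 'X) ?rootX ?oner_eq0 //.
rewrite size_polyX size_XsubC !mulrn_int.
clearbody j M; clear; move: (P0 g) (P1 g) (Pinf g) (size f) => a b c u.
by rewrite [2.-1]/= PoszM; lia.
Qed.

End ComponentBound.

(** * Roots of unity and the polynomial of the curve *)

(** The nonzero elements are all the roots of unity of order #|K| - 1. *)
Lemma finField_prim_root (K : finFieldType) m :
  (m %| #|K|.-1)%N -> exists zeta : K, m.-primitive_root zeta.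
Proof.
move=> mK; have K1 : (0 < #|K|.-1)%N by rewrite -subn1 subn_gt0 finNzRing_gt1.
pose rs := [seq a <- enum K | a != 0].
have rs1 : all #|K|.-1.-unity_root rs.
  apply/allP => a; rewrite mem_filter => /andP[a0 _]; rewrite unity_rootE.
  apply/eqP; apply: (mulfI a0); rewrite mulr1 -exprS prednK ?expf_card //.
  exact: ltnW (finNzRing_gt1 K).
have Urs : uniq rs by rewrite filter_uniq // enum_uniq.
have srs : (#|K|.-1 <= size rs)%N.
  rewrite -(cardC1 (0 : K)) cardE /rs enumT /enum_mem.
  by rewrite (@eq_filter _ (mem (predC1 0)) (fun a : K => a != 0)).
have /hasP[zeta _ zP] := has_prim_root K1 rs1 Urs srs.
by exists (zeta ^+ (#|K|.-1 %/ m)); exact: dvdn_prim_root zP _ mK.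
Qed.

Section CurvePolynomial.
Variables (K : fieldType) (q : nat).
Hypothesis pchar2 : 2%N \in [pchar K].
Hypothesis q4 : (4 <= q)%N.
Hypothesis q_even : ~~ odd q.

(** The quotient of 'X^(q-1) - 1 by 'X - 1. *)
Definition cyclo_quotient : {poly K} := \sum_(i < q.-1) 'X^i.
Local Notation f := cyclo_quotient.

Lemma cyclo_quotientE : ('X - 1) * f = 'X^(q.-1) - 1.
Proof. by rewrite subrX1. Qed.

Lemma size_cyclo_quotient : (size f).-1 = (q - 2)%N.
Proof.
have f0 : f != 0.
  apply/eqP => f0; have := cyclo_quotientE; rewrite f0 mulr0 => /esym/eqP.
  by rewrite -size_poly_eq0 size_XnsubC //; lia.
have := congr1 (fun p : {poly K} => size p) cyclo_quotientE.
have X1 : size ('X - 1 : {poly K}) = 2%N by exact: (size_XsubC 1).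
rewrite size_monicM ?(monicXsubC 1) // X1 size_XnsubC; last by lia.
by move: f0; rewrite -size_poly_eq0; move: (size f); lia.
Qed.

Lemma cyclo_quotient_separable : separable_poly (('X - 1) * f).
Proof.
rewrite cyclo_quotientE; apply: cyclotomic.separable_Xn_sub_1.
by rewrite -(dvdn_pcharf pchar2) dvdn2; lia.
Qed.

Lemma cyclo_quotient_root0 : ~~ root f 0.
Proof.
apply/negP => /rootP f0; have := congr1 (horner^~ 0) cyclo_quotientE.
rewrite !hornerE f0 mulr0 expr0n; have -> : (q.-1 == 0)%N = false by lia.
by move/eqP; rewrite eq_sym add0r oppr_eq0 oner_eq0.
Qed.

Lemma cyclo_quotient_root1 : ~~ root f 1.
Proof.
have := cyclo_quotient_separable; rewrite separable_mul => /and3P[_ _].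
by rewrite coprimep_sym coprimep_XsubC.
Qed.

Lemma cyclo_quotient_sqfree p : irreducible_poly p -> ~~ (p * p %| f).
Proof.
move=> [p1 _]; apply/negP => ppf.
have [/(_ p p) co _] := separable_polyP cyclo_quotient_separable.
have := co (dvdp_trans ppf (dvdp_mull _ (dvdpp _))).
by rewrite coprimepp => /eqP sp; rewrite sp in p1.
Qed.

End CurvePolynomial.

(** * Arithmetic of the orders *)

Section GapArithmetic.
Variables (q s : int).
Hypotheses (q4 : 4 <= q) (s_gt0 : 0 < s).
Let N := (q + 1) * s.

Let N_gt0 : 0 < N. Proof. by rewrite /N; nia. Qed.

(** The prescribed order -t at one place forces v = -1 and k = N - t. Then
    (a - 1) s < t gives j <= q + 1 - a, while the regularity at infinity and the
    upper bound on t give vinf > q^2 - q - a (q - 2) - d. With w >= d - 1 the sum of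
    the three orders is too large. *)
Lemma two_place_arith (a t d k j v w vinf : int) :
  0 <= k < N -> j * s <= k -> 0 < t <= N -> (a - 1) * s < t ->
  t * (q ^+ 2 - q) < N * (a * (q - 2) + d) ->
  v * N + k = - t -> d - 1 <= w -> 0 <= vinf * N - k * (q ^+ 2 - q) ->
  v + w + vinf <= j * (q - 2) -> False.
Proof.
move=> kN jk tN at_ tq Ev dw Hinf Hsum.
have v1 : v = -1 by move: N_gt0 kN tN Ev; clear; nia.
have Ek : k = N - t by move: Ev; rewrite v1; lia.
have ja : j <= q + 1 - a.
  have : j * s < (q + 2 - a) * s by move: jk at_; rewrite Ek /N; clear; lia.
  by rewrite ltr_pM2r //; lia.
have Hv : q ^+ 2 - q - a * (q - 2) - d < vinf.
  rewrite -(ltr_pM2r N_gt0); move: Hinf tq; rewrite Ek; clear; lia.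
have jq : j * (q - 2) <= (q + 1 - a) * (q - 2).
  by rewrite ler_wpM2r //; move: q4; clear; lia.
move: jq Hsum Hv dw; rewrite v1 expr2; clear; lia.
Qed.

(** As k < N, j is at most q; and the orders v, w and vinf are bounded below by
    integers whose sum is q^2 - 2 q + 1 > q (q - 2). *)
Section AtInfinity.
Variables (a b k j v w vinf : int).
Hypotheses (a0 : 0 <= a) (b1 : 1 <= b) (bs : b <= s - 1 - a).
Hypotheses (kN : 0 <= k < N) (jk : j * s <= k).
Hypothesis Hw : 0 <= w * N + k.
Hypothesis Hsum : v + w + vinf <= j * (q - 2).
Let S := N * (q - 1) - (s - a) * (q ^+ 2 - q).

Let w0 : 0 <= w. Proof. by move: N_gt0 kN Hw; clear; nia. Qed.

Let jq : j * (q - 2) <= q * (q - 2).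
Proof.
rewrite ler_wpM2r //; first by move: q4; clear; lia.
suff : j * s < (q + 1) * s by rewrite ltr_pM2r //; lia.
by move: jk kN; rewrite /N; clear; lia.
Qed.

Lemma infinity_arith_finite :
  v * N + k = - b -> - S <= vinf * N - k * (q ^+ 2 - q) -> False.
Proof.
move=> Ev Hinf.
have bN : b < N by move: bs q4 s_gt0 a0; rewrite /N; clear; nia.
have v1 : v = -1 by move: N_gt0 kN b1 bN Ev; clear; nia.
have Ek : k = N - b by move: Ev; rewrite v1; lia.
have q20 : 0 < q ^+ 2 - q by move: q4; rewrite expr2; clear; nia.
have Hv : q ^+ 2 - 2 * q + 1 < vinf.
  rewrite -(ltr_pM2r N_gt0); move: Hinf; rewrite Ek /S.
  have : 0 < (s - a - b) * (q ^+ 2 - q) by rewrite mulr_gt0 //; move: bs; clear; lia.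
  clear; lia.
move: jq Hsum Hv w0; rewrite v1 expr2; clear; lia.
Qed.

(** Modulo N the prescribed order determines k, since q^2 - q is invertible;
    this gives k = N - (s - a). *)
Lemma infinity_arith_infinite : coprimez (- (q ^+ 2 - q)) N ->
  - b <= v * N + k -> vinf * N - k * (q ^+ 2 - q) = - S -> False.
Proof.
move=> co Hv Einf.
have sa : 0 < s - a <= s by move: a0 b1 bs; clear; lia.
have : (N %| k + s - a)%Z.
  rewrite -(Gauss_dvdzr (m := N) (n := - (q ^+ 2 - q))); last by rewrite coprimez_sym.
  apply/dvdzP; exists (- vinf - (q - 1)); move: Einf; rewrite /S; clear; lia.
case/dvdzP=> m Em.
have sN : s <= N by move: q4 s_gt0; rewrite /N; clear; nia.
have m1 : m = 1 by move: N_gt0 sN sa kN Em; clear; nia.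
have Ek : k = N - (s - a) by move: Em; rewrite m1; lia.
have v0 : 0 <= v.
  by move: N_gt0 Hv bs; rewrite Ek; clear; nia.
have Ev : vinf = (q - 1) ^+ 2.
  apply: (mulIf (lt0r_neq0 N_gt0)); move: Einf; rewrite Ek /S !expr2; clear; lia.
move: jq Hsum v0 w0; rewrite Ev !expr2; clear; lia.
Qed.

End AtInfinity.
End GapArithmetic.

(** With r = (q^(n-1) - 1) / (q^2 - 1), all the quantities of the theorem are
    polynomials in q and r: s = r (q^2 - q) + 1, q^n + 1 = (q + 1) s, and
    a (q^n - 2 q^(n-1) + 1) / (q - 1) = a (r (q^2 - q - 2) + 1). *)
Section OrderBounds.
Variables (q r a b : int).
Hypotheses (q4 : 4 <= q) (r0 : 0 <= r) (a1 : 1 <= a <= q + 1).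
Let s := r * (q ^+ 2 - q) + 1.
Let N := (q + 1) * s.
Let c := a * (r * (q ^+ 2 - q - 2) + 1).

Let q20 : 12 <= q ^+ 2 - q. Proof. by move: q4; rewrite expr2; clear; nia. Qed.
Let q21 : 2 * q + 2 < q ^+ 2 - q.
Proof. by move: q4; rewrite expr2; clear; nia. Qed.
Let rq0 : 0 <= r * (q ^+ 2 - q).
Proof. by rewrite mulr_ge0 //; move: q20; clear; lia. Qed.
Let N_gt0 : 0 < N.
Proof. by rewrite mulr_gt0 //; rewrite /s; move: rq0 q4; clear; lia. Qed.

(** A decrease of c by 1 lowers the left-hand side by q^2 - q, which is more than
    the excess 2 a. *)
Let cE : c * (q ^+ 2 - q) = N * (a * (q - 2)) + 2 * a.
Proof. by rewrite /c /N /s; ring. Qed.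

Let le_N t : t * (q ^+ 2 - q) < N * (a * (q - 2) + 1) -> t <= N.
Proof.
move=> Ht; have q2_gt0 : 0 < q ^+ 2 - q by move: q20; clear; lia.
rewrite -(ler_pM2r q2_gt0); apply: le_trans (ltW Ht) _.
rewrite ler_pM2l //; have : a * (q - 2) <= (q + 1) * (q - 2).
  by rewrite ler_wpM2r //; [move: q4|move: a1]; clear; lia.
rewrite expr2; clear; lia.
Qed.

Lemma below_order_bounds : 1 <= b <= (q ^+ 2 - q - 2 * a) * r ->
  [/\ (a - 1) * s < c - b, c - b <= N &
      (c - b) * (q ^+ 2 - q) < N * (a * (q - 2))].
Proof.
move=> /andP[b1 bb].
have H : (c - b) * (q ^+ 2 - q) < N * (a * (q - 2)).
  rewrite mulrBl cE; have : q ^+ 2 - q <= b * (q ^+ 2 - q).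
    by rewrite ler_peMl //; move: q20; clear; lia.
  by move: q21 a1; clear; lia.
split=> //; first by move: bb; rewrite /c /s; clear; lia.
by apply: le_N; rewrite mulrDr; move: H N_gt0; clear; lia.
Qed.

Lemma above_order_bounds : 0 <= b ->
  2 * a <= q /\ b <= 2 * a * r \/ b <= r * (q + 1) - 1 ->
  [/\ (a - 1) * s < c + b, c + b <= N &
      (c + b) * (q ^+ 2 - q) < N * (a * (q - 2) + 1)].
Proof.
move=> b0 hb.
have H : (c + b) * (q ^+ 2 - q) < N * (a * (q - 2) + 1).
  have q2_ge0 : 0 <= q ^+ 2 - q by move: q20; clear; lia.
  rewrite mulrDl cE; case: hb => [[aq /(ler_wpM2r q2_ge0) bb]|/(ler_wpM2r q2_ge0) bb].
    suff : 2 * a * r * (q ^+ 2 - q) + 2 * a < N by move: bb; clear; lia.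
    have -> : 2 * a * r * (q ^+ 2 - q) + 2 * a = 2 * a * s by rewrite /s; ring.
    by rewrite ltr_pM2r; [move: aq|rewrite /s; move: rq0]; clear; lia.
  have : (r * (q + 1) - 1) * (q ^+ 2 - q) = N - (q + 1) - (q ^+ 2 - q).
    by rewrite /N /s; ring.
  by move: bb q21 a1; clear; lia.
split=> //; last exact: le_N.
have : 0 <= r * (q ^+ 2 - q - 2 * a).
  by rewrite mulr_ge0 //; move: q21 a1; clear; lia.
by move: b0; rewrite /c /s; clear; lia.
Qed.

End OrderBounds.

(** * The curve *)

Section Curve.
Variables (q n s : nat).
Hypothesis q2 : exists m : nat, q = (2 ^ m)%N.
Hypothesis q4 : (4 <= q)%N.
Let N := (q ^ n + 1)%N.
Hypothesis n_gt0 : (0 < n)%N.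
Hypothesis Ns : N = (s * (q + 1))%N.
Variable K : finFieldType.
Hypothesis hK : #|K| = (q ^ (2 * n))%N.
Variables (F : fieldExtType (ratfun K)) (y : F).
Local Notation emb a := ((tofrac a)%:A : F).
Local Notation x := (emb 'X).
Hypothesis hy : y ^+ N =
  x * (x + 1) * ((x ^+ (q - 1) + 1) / (x + 1)) ^+ (q + 1).
Hypothesis hF : <<1; y>>%VS = fullv.
Variables (Pinf P0 P1 : place (cst_ratfun K)).
Hypotheses (hPinf : Pinf 'X%:F < 0) (hP0 : 0 < P0 'X%:F).
Hypothesis hP1 : 0 < P1 ('X - 1)%:F.
Variables (Qinf Q0 Q1 : place (cst_ext F)).
Hypothesis hQinf : forall f, Qinf f%:A = Pinf f *+ \dim {:F}.
Hypothesis hQ0 : forall f, Q0 f%:A = P0 f *+ \dim {:F}.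
Hypothesis hQ1 : forall f, Q1 f%:A = P1 f *+ \dim {:F}.

Local Notation f := (cyclo_quotient K q).

Lemma q_even : ~~ odd q.
Proof.
by case: q2 q4 => -[|m] -> //; rewrite expnS oddM.
Qed.

Lemma pchar2 : 2%N \in [pchar K].
Proof.
have [m qm] := q2; apply: (@card_finPcharP _ _ (m * (2 * n))) => //.
by rewrite hK qm -expnM.
Qed.

Let N_odd : odd N.
Proof. by rewrite /N oddD oddX (negPf q_even) orbF (gtn_eqF n_gt0). Qed.

Let N_neq0 : N%:R != 0 :> K.
Proof. by rewrite -(dvdn_pcharf pchar2) dvdn2 negbK. Qed.

Let s_gt0 : (0 < s)%N.
Proof. by move: Ns; rewrite /N; case: s => //; lia. Qed.

Let polyN1 : - 1 = 1 :> {poly K}.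
Proof. by rewrite -polyC1 -polyCN (oppr_pchar2 pchar2). Qed.

Let X0 : 'X != 0 :> {poly K}. Proof. by rewrite polyX_eq0. Qed.
Let X10 : 'X - 1 != 0 :> {poly K}. Proof. by rewrite polyXsubC_eq0. Qed.
Let f0 : f != 0.
Proof.
apply/negP => /eqP E; have := cyclo_quotient_root0 pchar2 q4 q_even.
by rewrite E root0.
Qed.

(** In characteristic 2 the right-hand side of the equation of the curve is a
    polynomial in x. *)
Lemma curve_equation : y ^+ N = emb ('X * ('X - 1) * f ^+ (q + 1)).
Proof.
rewrite hy !embM embX; congr (_ * _ ^+ _).
  by rewrite polyN1 embD emb1.
have -> : x + 1 = emb ('X - 1) by rewrite polyN1 embD emb1.
have -> : x ^+ (q - 1) + 1 = emb ('X - 1) * emb f.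
  by rewrite -embM cyclo_quotientE polyN1 embD embX emb1 subn1.
by rewrite mulrC mulKf ?emb_neq0.
Qed.

Let h_neq0 : 'X * ('X - 1) * f ^+ (q + 1) != 0.
Proof. by rewrite !mulf_neq0 ?expf_neq0. Qed.

Let N_gt0 : (0 < N)%N. Proof. by rewrite /N addn1. Qed.

Let y0 : y != 0.
Proof.
apply/eqP => y0; have := curve_equation; rewrite y0 expr0n gtn_eqF //.
by move/eqP; rewrite eq_sym (negPf (emb_neq0 F h_neq0)).
Qed.

Let hP0' : 0 < P0 ('X - 0%:P)%:F. Proof. by rewrite subr0. Qed.

Let P0h : P0 ('X * ('X - 1) * f ^+ (q + 1))%:F = 1.
Proof.
rewrite (place_mup hP0') // mulrAC !mupMl ?mup_X //.
  by rewrite rootE horner_exp expf_eq0 addn1 /= -rootE cyclo_quotient_root0 ?pchar2 ?q_even.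
by rewrite root_XsubC eq_sym oner_eq0.
Qed.

Let P1h : P1 ('X * ('X - 1) * f ^+ (q + 1))%:F = 1.
Proof.
rewrite (place_mup (a := 1) hP1) // mupMl; last first.
  by rewrite rootE horner_exp expf_eq0 addn1 /= -rootE cyclo_quotient_root1 ?pchar2 ?q_even.
by rewrite mupMr ?mup_Xsub1 // rootX oner_eq0.
Qed.

Let Pinfh : Pinf ('X * ('X - 1) * f ^+ (q + 1))%:F = - (q%:Z ^+ 2 - q%:Z).
Proof.
have tf a : a != 0 -> a%:F != 0 :> ratfun K by rewrite tofrac_eq0.
have X0' := tf _ X0; have X10' := tf _ X10; have f0' := tf _ f0.
rewrite !tofracM tofracXn (place_valM _ (mulf_neq0 X0' X10') (expf_neq0 _ f0')).
rewrite (place_valM _ X0' X10') (placeX Pinf f%:F) !(place_deg hPinf) //.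
rewrite size_cyclo_quotient ?pchar2 ?q_even // mulrn_int size_polyX.
have -> : size ('X - 1 : {poly K}) = 2%N by exact: (size_XsubC 1).
rewrite expr2; move: q4; clear; rewrite !succnK; nia.
Qed.

(** Total ramification at a simple zero of the right-hand side: the degree is
    N times the order of y at Q0, and it is at most N. *)
Lemma curve_dim : \dim {:F} = N.
Proof.
have dN := kummer_dim_le N_gt0 curve_equation hF.
have d0 : (0 < \dim {:F})%N by rewrite adim_gt0.
have := placeX Q0 y N; rewrite curve_equation hQ0 P0h !mulrn_int mul1r => E.
have : (N %| \dim {:F})%N by apply/dvdnP; exists (absz (Q0 y)); lia.
by move/(dvdn_leq d0) => dN'; apply/eqP; rewrite eqn_leq dN.
Qed.

Let NZ0 : N%:Z != 0. Proof. by rewrite eqz_nat -lt0n. Qed.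

Lemma curve_Q0y : Q0 y = 1.
Proof.
have := placeX Q0 y N; rewrite curve_equation hQ0 P0h curve_dim !mulrn_int.
by move/(mulIf NZ0).
Qed.

Lemma curve_Q1y : Q1 y = 1.
Proof.
have := placeX Q1 y N; rewrite curve_equation hQ1 P1h curve_dim !mulrn_int.
by move/(mulIf NZ0).
Qed.

Lemma curve_Qinfy : Qinf y = - (q%:Z ^+ 2 - q%:Z).
Proof.
have := placeX Qinf y N; rewrite curve_equation hQinf Pinfh curve_dim !mulrn_int.
by move/(mulIf NZ0).
Qed.

(** N is 1 modulo q and 2 modulo q - 1, which is odd. *)
Lemma curve_Qinf_coprime : coprimez (Qinf y) N.
Proof.
rewrite curve_Qinfy coprimeNz.
have -> : q%:Z ^+ 2 - q%:Z = (q * (q - 1))%N%:Z.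
  by move: q4; clear; rewrite expr2; nia.
rewrite /coprimez /gcdz /= -[_ == _]/(coprime _ _) coprimeMl; apply/andP; split.
  rewrite /N -(prednK n_gt0) expnS mulnC /coprime.
  by rewrite gcdnMDl gcdn1.
have E : (q ^ n = (q ^ n).-1 + 1)%N.
  by rewrite addn1 prednK // expn_gt0; move: q4; clear; case: q.
rewrite /N E predn_exp -addnA mulnC /coprime -subn1 gcdnMDl.
rewrite -[_ == _]/(coprime _ (2 ^ 1)) coprime_pexpr // coprimen2.
by move: q_even q4; clear; case: q => //= m; rewrite subn1 /= negbK.
Qed.

Let ram0 : kummer_ramified (cst_ratfun K) N y Q0.
Proof.
split; first by rewrite curve_Q0y /coprimez gcd1z.
by exists P0 => a; rewrite hQ0 curve_dim.
Qed.

Let ram1 : kummer_ramified (cst_ratfun K) N y Q1.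
Proof.
split; first by rewrite curve_Q1y /coprimez gcd1z.
by exists P1 => a; rewrite hQ1 curve_dim.
Qed.

Let raminf : kummer_ramified (cst_ratfun K) N y Qinf.
Proof.
split; first exact: curve_Qinf_coprime.
by exists Pinf => a; rewrite hQinf curve_dim.
Qed.

(** Every order at Q0, Q1 or Qinf of a function z regular elsewhere is the order
    of one monomial g * y ^+ k, all of whose orders are at least those of z.
    They are expressed here by k and by the orders v0, v1, vinf of g at 0, 1 and
    infinity, which satisfy the ramification bound. *)
Lemma curve_component (T : place (cst_ext F)) z :
  T = Q0 \/ T = Q1 \/ T = Qinf -> z != 0 ->
  (forall P : place (cst_ext F), P <> Q0 -> P <> Q1 -> P <> Qinf -> 0 <= P z) ->
  exists (k : nat) (v0 v1 vinf : int),
    [/\ (k < N)%N, v0 + v1 + vinf <= (k %/ s * (q - 2))%N%:Z &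
      let o0 := v0 * N%:Z + k%:Z in
      let o1 := v1 * N%:Z + k%:Z in
      let oinf := vinf * N%:Z - k%:Z * (q%:Z ^+ 2 - q%:Z) in
      [/\ Q0 z <= o0, Q1 z <= o1, Qinf z <= oinf &
        [/\ T = Q0 -> Q0 z = o0, T = Q1 -> Q1 z = o1 &
             T = Qinf -> Qinf z = oinf]]].
Proof.
move=> hT z0 zreg.
have Tram : kummer_ramified (cst_ratfun K) N y T by case: hT => [|[]] ->.
have [zeta zetaP] : exists zeta : K, N.-primitive_root zeta.
  apply: finField_prim_root; rewrite hK mulnC expnM -/N -subn1.
  by rewrite -[X in (_ - X)%N](exp1n 2) subn_sqr dvdn_mull.
have cE c : cst_ext F c = (cst_ratfun K c)%:A by [].
have [k [g [kN g0 Tk lek regk]]] :=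
  kummer_component cE curve_equation hF curve_dim zetaP N_neq0 y0 Tram z0.
have reg (P : place (cst_ext F)) :
    P (emb 'X) = 0 -> P (emb ('X - 1)) = 0 -> 0 <= P (g%:A * y ^+ k).
  move=> PX PX1; apply: regk => sigma.
  have sL (c : ratfun K) : sigma c%:A = c%:A by rewrite linearZ /= rmorph1.
  (* A conjugate of P has the values of P on K(x), so it lies over neither of
     0, 1 and infinity. *)
  have [P' P'E] := @place_aut _ _ F (cst_ext F) P sigma (fun c => sL (cst_ratfun K c)).
  right; rewrite -P'E; apply: zreg => P'Q.
  - have := hQ0 'X%:F; rewrite -P'Q P'E sL PX curve_dim mulrn_int.
    by move/esym/eqP; rewrite mulf_eq0 (negPf NZ0) orbF gt_eqF.
  - have := hQ1 ('X - 1)%:F; rewrite -P'Q P'E sL PX1 curve_dim mulrn_int.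
    by move/esym/eqP; rewrite mulf_eq0 (negPf NZ0) orbF gt_eqF.
  have := hQinf 'X%:F; rewrite -P'Q P'E sL PX curve_dim mulrn_int.
  by move/esym/eqP; rewrite mulf_eq0 (negPf NZ0) orbF lt_eqF.
have yst : y ^+ (s * (q + 1)) = emb ('X * ('X - 1) * f ^+ (q + 1)).
  by rewrite -Ns curve_equation.
have q1_gt0 : (0 < q + 1)%N by rewrite addn1.
have bound := component_bound s_gt0 q1_gt0
  (cyclo_quotient_sqfree pchar2 q4 q_even) (cyclo_quotient_root0 pchar2 q4 q_even)
  (cyclo_quotient_root1 pchar2 q4 q_even) yst y0 g0 reg hP0 hP1 hPinf.
rewrite size_cyclo_quotient ?pchar2 ?q_even // in bound.
have gA0 : (g%:A : F) != 0 by rewrite (fmorph_eq0 (in_alg F)).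
have o0E : Q0 (g%:A * y ^+ k) = P0 g * N%:Z + k%:Z.
  by rewrite place_valM ?expf_neq0 // placeX hQ0 curve_Q0y curve_dim mulrn_int natz.
have o1E : Q1 (g%:A * y ^+ k) = P1 g * N%:Z + k%:Z.
  by rewrite place_valM ?expf_neq0 // placeX hQ1 curve_Q1y curve_dim mulrn_int natz.
have oinfE : Qinf (g%:A * y ^+ k) = Pinf g * N%:Z - k%:Z * (q%:Z ^+ 2 - q%:Z).
  rewrite place_valM ?expf_neq0 // placeX hQinf curve_Qinfy curve_dim !mulrn_int.
  by rewrite mulNr [X in _ - X]mulrC.
exists k, (P0 g), (P1 g), (Pinf g); split=> //=.
rewrite -o0E -o1E -oinfE; split; try exact: lek.
by split=> ET; rewrite -ET Tk.
Qed.

Let Q0x : 0 < Q0 x.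
Proof. by rewrite hQ0 curve_dim mulrn_int mulr_gt0. Qed.
Let Q1x : Q1 x = 0.
Proof.
by rewrite hQ1 (place_nonroot (a := 1) hP1) ?mul0rn // rootX oner_eq0.
Qed.
Let Qinfx : Qinf x < 0.
Proof. by rewrite hQinf curve_dim mulrn_int pmulr_llt0. Qed.

Let Q01 : Q0 <> Q1. Proof. by move=> E; move: Q0x; rewrite E Q1x. Qed.
Let Q0inf : Q0 <> Qinf.
Proof. by move=> E; move: Q0x; rewrite E ltNge ltW. Qed.
Let Q1inf : Q1 <> Qinf. Proof. by move=> E; move: Qinfx; rewrite -E Q1x. Qed.

Let qz := q%:Z.
Let sz := s%:Z.
Let NZ : N%:Z = (qz + 1) * sz.
Proof. by rewrite /qz /sz Ns; lia. Qed.
Let qz4 : 4 <= qz. Proof. by []. Qed.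
Let sz0 : 0 < sz. Proof. by []. Qed.
Let kdiv k : (k %/ s)%N%:Z * sz <= k%:Z.
Proof. by rewrite /sz -PoszM lez_nat leq_trunc_div. Qed.
Let kbound k : (k < N)%N -> 0 <= k%:Z < (qz + 1) * sz.
Proof. by move=> kN; rewrite -NZ; lia. Qed.
Let jbound k : (k %/ s * (q - 2))%N%:Z = (k %/ s)%N%:Z * (qz - 2).
Proof. by rewrite PoszM; congr (_ * _); rewrite /qz; lia. Qed.

(** Bounds on t which exclude a monomial of order -t at Q0 or Q1 that is regular
    at Qinf and whose coefficient has order at least d - 1 at the other one of 0
    and 1. *)
Definition gap_order (a t d : int) : Prop :=
  [/\ 0 < t <= N%:Z, (a - 1) * sz < t &
      t * (qz ^+ 2 - qz) < N%:Z * (a * (qz - 2) + d)].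

(** If the larger of the two pole orders is prescribed, then the coefficient of
    the monomial has no pole at the other place, which is the case d = 1. *)
Lemma pure_gaps_Q0Q1 (t0 t1 a0 a1 d0 d1 : int) :
  gap_order a0 t0 d0 -> gap_order a1 t1 d1 ->
  d0 = 0 \/ d0 = 1 /\ t1 < t0 -> d1 = 0 \/ d1 = 1 /\ t0 < t1 ->
  pure_gaps Q0 Q1 (t0, t1).
Proof.
move=> [t0N at0 tq0] [t1N at1 tq1] hd0 hd1.
have kN k : (k < N)%N -> 0 <= k%:Z < N%:Z by rewrite ltz_nat.
have wbound (k t t' d w v : int) : 0 <= k < N%:Z -> 0 < t <= N%:Z ->
    0 < t' <= N%:Z -> d = 0 \/ d = 1 /\ t' < t -> v * N%:Z + k = - t ->
    - t' <= w * N%:Z + k -> d - 1 <= w.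
  move: N_gt0; rewrite -ltz_nat; move: (N%:Z) => M M0 kM tN tN' [->|[-> tt]] Ev Hw.
    by move: M0 kM tN' Hw; clear; nia.
  have : v = -1 by move: M0 kM tN Ev; clear; nia.
  by move: M0 tN' tt Ev Hw; clear; nia.
apply: pure_gapsI => //; try by move: t0N t1N; clear; lia.
move=> z z0 z0t z1t zreg.
have zinf : 0 <= Qinf z by apply: zreg => E; [apply: Q0inf|apply: Q1inf].
have zreg' P : P <> Q0 -> P <> Q1 -> P <> Qinf -> 0 <= P z.
  by move=> P0' P1' _; exact: zreg.
split; apply/eqP => Ez.
  have [k [v0 [v1 [vinf [/kN kN' sum_le [_ le1 leinf [/(_ erefl) E _ _]]]]]]] :=
    curve_component (or_introl erefl) z0 zreg'.
  rewrite Ez in E.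
  apply: (@two_place_arith qz sz qz4 sz0 a0 t0 d0 k (k %/ s)%N v0 v1 vinf);
    rewrite -?NZ -?jbound //.
  - by apply: (wbound k t0 t1 d0 v1 v0) => //; exact: le_trans le1.
  - exact: le_trans leinf.
have [k [v0 [v1 [vinf [/kN kN' sum_le [le0 _ leinf [_ /(_ erefl) E _]]]]]]] :=
  curve_component (or_intror (or_introl erefl)) z0 zreg'.
rewrite Ez in E.
apply: (@two_place_arith qz sz qz4 sz0 a1 t1 d1 k (k %/ s)%N v1 v0 vinf);
  rewrite -?NZ -?jbound //.
- by apply: (wbound k t1 t0 d1 v0 v1) => //; exact: le_trans le0.
- exact: le_trans leinf.
by rewrite [v1 + v0]addrC.
Qed.

Lemma pure_gaps_Qinf (Q : place (cst_ext F)) (a b : int) :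
  Q = Q0 \/ Q = Q1 -> 0 <= a -> 1 <= b -> b <= sz - 1 - a ->
  pure_gaps Qinf Q (N%:Z * (qz - 1) - (sz - a) * (qz ^+ 2 - qz), b).
Proof.
move=> hQ a0 b1 bs; set S := _ - _.
have SE : S = (qz + 1) * sz * (qz - 1) - (sz - a) * (qz ^+ 2 - qz).
  by rewrite /S NZ.
have S0 : 0 <= S.
  have : 0 <= a * (qz ^+ 2 - qz).
    by rewrite mulr_ge0 //; move: qz4; rewrite expr2; clear; nia.
  have : 0 <= sz * (qz - 1) by move: sz0 qz4; clear; nia.
  rewrite SE; clear; lia.
have QQinf : Q <> Qinf by case: hQ => ->.
have cop : coprimez (- (qz ^+ 2 - qz)) ((qz + 1) * sz).
  by rewrite -NZ -curve_Qinfy curve_Qinf_coprime.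
apply: pure_gapsI => //; [by move=> E; exact: QQinf|by move: b1; clear; lia|].
move=> z z0 zSinf zb zreg.
have zreg' P : P <> Q0 -> P <> Q1 -> P <> Qinf -> 0 <= P z.
  by move=> P0' P1' Pi; apply: zreg => // PQ; case: hQ => E; rewrite E in PQ.
(* v and w are the orders of g below Q and below the other one of Q0, Q1. *)
have comp T : T = Q \/ T = Qinf -> exists (k : nat) (v w vinf : int),
    [/\ (k < N)%N, v + w + vinf <= (k %/ s * (q - 2))%N%:Z,
        0 <= w * N%:Z + k%:Z &
        [/\ Q z <= v * N%:Z + k%:Z,
            Qinf z <= vinf * N%:Z - k%:Z * (qz ^+ 2 - qz),
            T = Q -> Q z = v * N%:Z + k%:Z &
            T = Qinf -> Qinf z = vinf * N%:Z - k%:Z * (qz ^+ 2 - qz)]].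
  case: hQ => EQ; rewrite {}EQ in QQinf zb zreg *; case=> ET; rewrite {}ET.
  - have [k [v0 [v1 [vinf [kN sumv [o0 o1 oinf [E0 _ Einf]]]]]]] :=
      curve_component (or_introl erefl) z0 zreg'.
    exists k, v0, v1, vinf; split=> //; apply: le_trans o1.
    by apply: zreg => // E; apply: Q01.
  - have [k [v0 [v1 [vinf [kN sumv [o0 o1 oinf [E0 _ Einf]]]]]]] :=
      curve_component (or_intror (or_intror erefl)) z0 zreg'.
    exists k, v0, v1, vinf; split=> //; apply: le_trans o1.
    by apply: zreg => // E; apply: Q01.
  - have [k [v0 [v1 [vinf [kN sumv [o0 o1 oinf [_ E1 Einf]]]]]]] :=
      curve_component (or_intror (or_introl erefl)) z0 zreg'.
    exists k, v1, v0, vinf; split=> //; first by rewrite [v1 + v0]addrC.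
    by apply: le_trans o0; apply: zreg => // E; apply: Q01.
  have [k [v0 [v1 [vinf [kN sumv [o0 o1 oinf [_ E1 Einf]]]]]]] :=
    curve_component (or_intror (or_intror erefl)) z0 zreg'.
  exists k, v1, v0, vinf; split=> //; first by rewrite [v1 + v0]addrC.
  by apply: le_trans o0; apply: zreg => // E; apply: Q01.
split; apply/eqP => Ez.
  have [k [v [w [vinf [kN sumv ow [oQ _ _ /(_ erefl) E]]]]]] :=
    comp _ (or_intror erefl).
  rewrite Ez in E.
  apply: (@infinity_arith_infinite qz sz qz4 sz0 a b k (k %/ s)%N v w vinf);
    rewrite -?jbound -?NZ ?kbound //; first by rewrite NZ.
  exact: le_trans oQ.
have [k [v [w [vinf [kN sumv ow [_ oinf /(_ erefl) E _]]]]]] :=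
  comp _ (or_introl erefl).
rewrite Ez in E.
apply: (@infinity_arith_finite qz sz qz4 sz0 a b k (k %/ s)%N v w vinf);
  rewrite -?jbound -?NZ ?kbound //.
exact: le_trans oinf.
Qed.

End Curve.

(** * The theorem *)

Lemma odd_power_decomposition (q n : nat) : (0 < q)%N -> odd n ->
  exists r : nat, (q ^ n.-1 = r * (q ^ 2 - 1) + 1)%N.
Proof.
move=> q0 n_odd; exists (\sum_(i < n./2) (q ^ 2) ^ i)%N.
have -> : n.-1 = (2 * n./2)%N by rewrite -[in LHS](odd_double_half n) n_odd mul2n.
rewrite expnM mulnC subn1 -predn_exp addn1 prednK //.
by rewrite !expn_gt0 q0.
Qed.

Theorem proposition6p1
  (q n : nat) (hq : exists m : nat, q = (2 ^ m)%N) (hq4 : (4 <= q)%N)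
  (hn : odd n) (hn3 : (3 <= n)%N)
  (* F is the function field of the curve over the field K with q^(2n) elements *)
  (K : finFieldType) (hK : #|K| = (q ^ (2 * n))%N)
  (F : fieldExtType (ratfun K)) (x y : F) (hx : x = (ratfun_x K)%:A)
  (hy : y ^+ (q ^ n + 1) =
        x * (x + 1) * ((x ^+ (q - 1) + 1) / (x + 1)) ^+ (q + 1))
  (hF : <<1; y>>%VS = fullv)
  (* the pole of x, the zero of x and the zero of x - 1 in K(x) *)
  (Pinf P0 P1 : place (cst_ratfun K))
  (hPinf : Pinf (ratfun_x K) < 0)
  (hP0 : 0 < P0 (ratfun_x K))
  (hP1 : 0 < P1 (ratfun_x K - 1))
  (Qinf Q0 Q1 : place (cst_ext F))
  (hQinf : totally_ramified Qinf Pinf)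
  (hQ0 : totally_ramified Q0 P0)
  (hQ1 : totally_ramified Q1 P1)
  (Q : place (cst_ext F)) (hQ : Q = Q0 \/ Q = Q1) :
  (* all the integer divisions below are exact *)
  let qz : int := q%:Z in
  let s : int := ((qz ^+ n + 1) %/ (qz + 1))%Z in
  let c (a : int) : int :=
    ((a * (qz ^+ n - 2 * qz ^+ (n - 1) + 1)) %/ (qz - 1))%Z in
  let r : int := ((qz ^+ (n - 1) - 1) %/ (qz ^+ 2 - 1))%Z in
  [/\ (forall a b : int,
         0 <= a <= s - 2 -> 1 <= b <= s - 1 - a ->
         pure_gaps Qinf Q
           ((qz ^+ n + 1) * (qz - 1) - (s - a) * (qz ^+ 2 - qz), b)),
      (forall a1 a2 b1 b2 : int,
         1 <= a1 <= qz + 1 -> 1 <= b1 <= (qz ^+ 2 - qz - 2 * a1) * r ->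
         1 <= a2 <= qz + 1 -> 1 <= b2 <= (qz ^+ 2 - qz - 2 * a2) * r ->
         pure_gaps Q0 Q1 (c a2 - b2, c a1 - b1))
    & (forall a1 a2 b1 b2 : int,
         1 <= a2 -> a2 <= a1 -> a1 <= qz + 1 ->
         0 <= b1 <= (if a1 <= (qz %/ 2)%Z then 2 * a1 * r
                     else ((qz ^+ (n - 1) - qz) %/ (qz - 1))%Z) ->
         1 <= b2 <= (qz ^+ 2 - qz - 2 * a2) * r ->
         pure_gaps Q0 Q1 (c a1 + b1, c a2 - b2) /\
         pure_gaps Q0 Q1 (c a2 - b2, c a1 + b1))].
Proof.
move=> qz s c r.
have n0 : (0 < n)%N by lia.
have q_gt0 : (0 < q)%N by lia.
have [R HR] := odd_power_decomposition q_gt0 hn.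
have qz4 : 4 <= qz by [].
have powZ (a m : nat) : (a ^ m)%N%:Z = a%:Z ^+ m.
  by elim: m => // m IHm; rewrite expnS exprS PoszM IHm.
have q2_gt0 : (0 < q ^ 2)%N by rewrite expn_gt0 q_gt0.
have A1 : qz ^+ (n - 1) = R%:Z * (qz ^+ 2 - 1) + 1.
  by rewrite subn1 -powZ HR PoszD PoszM -subzn // powZ.
have An : qz ^+ n = qz * qz ^+ (n - 1) by rewrite -exprS subn1 prednK.
pose S : nat := (R * (q ^ 2 - q) + 1)%N.
have SZ : S%:Z = R%:Z * (qz ^+ 2 - qz) + 1.
  by rewrite /S PoszD PoszM -subzn ?powZ // -[X in (X <= _)%N]expn1 leq_pexp2l.
have qN : qz ^+ n + 1 = S%:Z * (qz + 1) by rewrite An A1 SZ; ring.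
have Ns : (q ^ n + 1 = S * (q + 1))%N.
  by apply/eqP; rewrite -eqz_nat PoszD PoszM PoszD powZ; apply/eqP.
have q1_neq0 : qz - 1 != 0 by move: qz4; clear; lia.
have sE : s = S%:Z by rewrite /s qN mulzK //; move: qz4; clear; lia.
have cE a : c a = a * (R%:Z * (qz ^+ 2 - qz - 2) + 1).
  rewrite /c An A1; have -> : a * (qz * (R%:Z * (qz ^+ 2 - 1) + 1) -
    2 * (R%:Z * (qz ^+ 2 - 1) + 1) + 1) =
    a * (R%:Z * (qz ^+ 2 - qz - 2) + 1) * (qz - 1) by ring.
  by rewrite mulzK.
have rE : r = R%:Z.
  rewrite /r A1 addrK mulzK // expr2; move: qz4; clear; nia.
have eE : ((qz ^+ (n - 1) - qz) %/ (qz - 1))%Z = R%:Z * (qz + 1) - 1.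
  rewrite A1; have -> : R%:Z * (qz ^+ 2 - 1) + 1 - qz =
    (R%:Z * (qz + 1) - 1) * (qz - 1) by ring.
  by rewrite mulzK.
have ramE (T : place (cst_ext F)) (P : place (cst_ratfun K)) :
    totally_ramified T P -> forall f, T f%:A = P f *+ \dim {: F} by case.
have hP1' : 0 < P1 ('X - 1)%:F by rewrite tofracB tofrac1.
rewrite hx in hy.
have gapsQ0Q1 := pure_gaps_Q0Q1 hq hq4 n0 Ns hK hy hF hPinf hP0 hP1'
  (ramE _ _ hQinf) (ramE _ _ hQ0) (ramE _ _ hQ1).
have gapsQinf := pure_gaps_Qinf hq hq4 n0 Ns hK hy hF hPinf hP0 hP1'
  (ramE _ _ hQinf) (ramE _ _ hQ0) (ramE _ _ hQ1).
have NZ : (q ^ n + 1)%N%:Z = (qz + 1) * (R%:Z * (qz ^+ 2 - qz) + 1).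
  by rewrite Ns PoszM PoszD SZ mulrC.
have R0 : 0 <= R%:Z by [].
have s_gt0 : 0 <= R%:Z * (qz ^+ 2 - qz).
  by rewrite mulr_ge0 // expr2; move: qz4; clear; nia.
have below a b : 1 <= a -> a <= qz + 1 ->
    1 <= b <= (qz ^+ 2 - qz - 2 * a) * r -> gap_order q n S a (c a - b) 0.
  move=> a1 aq; rewrite rE => hb.
  have a1q : 1 <= a <= qz + 1 by rewrite a1.
  have [H1 H2 H3] := below_order_bounds qz4 R0 a1q hb.
  rewrite /gap_order NZ SZ cE addr0; split=> //; rewrite H2 andbT.
  apply: le_lt_trans H1; rewrite mulr_ge0 //; first by move: a1; clear; lia.
  by move: s_gt0; clear; lia.
have above a b : 1 <= a -> a <= qz + 1 ->
    0 <= b <= (if a <= (qz %/ 2)%Z then 2 * a * r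
               else ((qz ^+ (n - 1) - qz) %/ (qz - 1))%Z) ->
    gap_order q n S a (c a + b) 1.
  move=> a1 aq; rewrite rE eE => /andP[b0 hb].
  have a1q : 1 <= a <= qz + 1 by rewrite a1.
  have hb' : 2 * a <= qz /\ b <= 2 * a * R%:Z \/ b <= R%:Z * (qz + 1) - 1.
    move: hb; case: ifP => [aq2 hb|_ hb]; last by right.
    by left; split=> //; move: aq2; clear; lia.
  have [H1 H2 H3] := above_order_bounds qz4 R0 a1q b0 hb'.
  rewrite /gap_order NZ SZ cE; split=> //; rewrite H2 andbT.
  apply: le_lt_trans H1; rewrite mulr_ge0 //; first by move: a1; clear; lia.
  by move: s_gt0; clear; lia.
split.
- move=> a b /andP[a0 _] /andP[b1 bs].
  have := gapsQinf Q a b hQ a0 b1; rewrite -sE => /(_ bs).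
  by rewrite PoszD powZ.
- move=> a1 a2 b1 b2 /andP[a1_ge a1_le] hb1 /andP[a2_ge a2_le] hb2.
  by apply: (gapsQ0Q1 _ _ a2 a1 0 0); [exact: below|exact: below|left|left].
move=> a1 a2 b1 b2 a2_ge a21 a1_le hb1 hb2.
have a1_ge := le_trans a2_ge a21; have a2_le := le_trans a21 a1_le.
have lt21 : c a2 - b2 < c a1 + b1.
  have : c a2 <= c a1.
    rewrite !cE ler_wpM2r //.
    have : 0 <= R%:Z * (qz ^+ 2 - qz - 2).
      by rewrite mulr_ge0 // expr2; move: qz4; clear; nia.
    by clear; lia.
  by case/andP: hb1 => b1_ge _; case/andP: hb2 => b2_ge _; lia.
split.
  by apply: (gapsQ0Q1 _ _ a1 a2 1 0); [exact: above|exact: below|right|left].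
by apply: (gapsQ0Q1 _ _ a2 a1 0 1); [exact: below|exact: above|left|right].
Qed.
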